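(* Let $\alpha>1$ and $r_0(\alpha)=1+\frac{2}{\alpha-1}$. For every $r_1>r_0(\alpha)$ there exists a smooth, strictly convex surface $M_0=x_0(S^2)\subset\mathbb{R}^3$ (with $x_0$ a smooth embedding) with pinching ratio equal to $r_1$ such that the following holds for every smooth, symmetric function $F$ on the positive cone $\{(a,b)\in\mathbb{R}^2: a>0,\ b>0\}$ that is homogeneous of degree $\alpha$ and has strictly positive partial derivative in each argument: if $x:S^2\times[0,T)\to\mathbb{R}^3$ is the smooth solution with strictly convex images, for some $T>0$, of $$\frac{\partial x}{\partial t}(z,t)=-F(\kappa_1(z,t),\kappa_2(z,t))\,\nu(z,t),\qquad x(z,0)=x_0(z),$$ then for all sufficiently small $t>0$ the pinching ratio of $M_t=x(S^2,t)$ is strictly larger than the pinching ratio of $M_0$.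
   Context: Here $\nu(z,t)$ is the outward unit normal and $\kappa_1(z,t),\kappa_2(z,t)$ are the principal curvatures of $M_t$ at $x(z,t)$, with the sign convention that they are positive on strictly convex surfaces (eigenvalues of $h_{ij}=-\langle \partial_i\partial_j x,\nu\rangle$ with respect to the induced metric). A smooth closed surface is called strictly convex if both principal curvatures are positive at every point. The pinching ratio of a strictly convex surface is the supremum over the surface of the ratio of the largest to the smallest principal curvature at each point. *)

(* Defs.v *)
From HB Require Import structures.
From mathcomp Require Import all_boot all_order all_algebra.
From mathcomp Require Import all_classical all_reals all_analysis.

Set Implicit Arguments.
Unset Strict Implicit.
Unset Printing Implicit Defensive.

Import Order.TTheory GRing.Theory Num.Theory.
Import numFieldNormedType.Exports.

Local Open Scope classical_set_scope.
Local Open Scope ring_scope.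

Section Smooth.
Context {R : realType} {V W : normedModType R}.

(* [Ck k U f]: [f] is of class C^k on the set [U], which is open in all uses. *)
Fixpoint Ck (k : nat) (U : set V) (f : V -> W) : Prop :=
  if k is k'.+1 then
    (forall p, U p -> differentiable f p) /\ (forall v, Ck k' U ('D_v f))
  else forall p, U p -> {for p, continuous f}.

(* Smoothness on an arbitrary subset [A] of [V]: near every point of [A], the
   restriction of [f] to [A] extends to a C^oo map on an open set of [V].  For
   the sphere this is smoothness on a submanifold, for S^2 x [0, T) it is
   smoothness up to the boundary t = 0, and for open [A] it is C^oo on [A].
   Only the values of [f] on [A] matter. *)
Definition smooth_on (A : set V) (f : V -> W) : Prop :=
  forall p, A p -> exists (U : set V) (g : V -> W),
    [/\ open U, U p, forall k, Ck k U g
      & forall q, A q -> U q -> f q = g q].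

End Smooth.

Section Surfaces.
Context {R : realType}.
Implicit Types (x : 'rV[R]_3 -> 'rV[R]_3) (z n : 'rV[R]_3).

Definition dot (u v : 'rV[R]_3) : R := (u *m v^T) 0 0.

(* The norm of the library on row vectors is the sup norm. *)
Definition euclid_norm (u : 'rV[R]_3) : R := Num.sqrt (dot u u).

Definition S2 : set 'rV[R]_3 := [set z | dot z z = 1].

(* The rows of [E] form a basis of the tangent plane of the sphere at [z]. *)
Definition tangent_frame z (E : 'M[R]_(2, 3)) : Prop :=
  z *m E^T = 0 /\ row_free E.

(* Local parametrization of the sphere sending 0 to [z]: central projection of
   the affine tangent plane at [z], with the coordinates given by [E]. *)
Definition chart z (E : 'M[R]_(2, 3)) (a : 'rV[R]_2) : 'rV[R]_3 :=
  (euclid_norm (z + a *m E))^-1 *: (z + a *m E).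

Definition partial (i : 'I_2) (f : 'rV[R]_2 -> 'rV[R]_3) :
    'rV[R]_2 -> 'rV[R]_3 := 'D_(delta_mx 0 i) f.

Definition dx x z E (i : 'I_2) : 'rV[R]_3 := partial i (x \o chart z E) 0.

Definition ddx x z E (i j : 'I_2) : 'rV[R]_3 :=
  partial i (partial j (x \o chart z E)) 0.

Definition immersion x : Prop :=
  forall z E, S2 z -> tangent_frame z E ->
    row_free (\matrix_(i < 2) dx x z E i).

Definition smooth_embedding x : Prop :=
  [/\ smooth_on S2 x, immersion x, set_inj S2 x
    & exists y : 'rV[R]_3 -> 'rV[R]_3,
        {within x @` S2, continuous y} /\ (forall z, S2 z -> y (x z) = z)].

(* The points lying in an unbounded component of the complement of [M]
   ([connected_component A p] is empty when [p] is not in [A]). *)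
Definition exterior (M : set 'rV[R]_3) : set 'rV[R]_3 :=
  [set p | ~ bounded_set (connected_component (~` M) p)].

Definition outward_unit_normal x z n : Prop :=
  [/\ dot n n = 1,
      forall E i, tangent_frame z E -> dot (dx x z E i) n = 0
    & \forall s \near 0^'+, exterior (x @` S2) (x z + s *: n)].

Definition metric x z E : 'M[R]_2 :=
  \matrix_(i, j) dot (dx x z E i) (dx x z E j).

Definition second_form x z E n : 'M[R]_2 :=
  \matrix_(i, j) - dot (ddx x z E i j) n.

(* [k1 <= k2] are, with multiplicity, the eigenvalues of the second fundamental
   form with respect to the metric; they do not depend on the frame [E]. *)
Definition principal_curvatures x z n (k1 k2 : R) : Prop :=
  k1 <= k2 /\ exists E, tangent_frame z E /\
    char_poly (second_form x z E n *m invmx (metric x z E)) =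
      ('X - k1%:P) * ('X - k2%:P).

Definition strictly_convex x : Prop :=
  forall z, S2 z -> exists n k1 k2,
    [/\ outward_unit_normal x z n, principal_curvatures x z n k1 k2,
        0 < k1 & 0 < k2].

Definition pinching_ratio x : \bar R :=
  ereal_sup [set r | exists z n k1 k2,
    [/\ S2 z, outward_unit_normal x z n, principal_curvatures x z n k1 k2
      & r = (k2 / k1)%:E]].

Definition positive_cone : set (R * R) := [set p | 0 < p.1 /\ 0 < p.2].

Definition admissible_speed (alpha : R) (F : R -> R -> R) : Prop :=
  [/\ smooth_on positive_cone (fun p : R * R => F p.1 p.2),
      forall a b : R, 0 < a -> 0 < b -> F a b = F b a,
      forall c a b : R, 0 < c -> 0 < a -> 0 < b ->
        F (c * a) (c * b) = c `^ alpha * F a b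
    & forall a b : R, 0 < a -> 0 < b ->
        0 < derive1 (fun s => F s b) a /\ 0 < derive1 (fun s => F a s) b].

(* [v] is the derivative at [t] of a curve defined on [0, T); it is one-sided
   at [t = 0]. *)
Definition has_time_derivative (T : R) (c : R -> 'rV[R]_3) (t : R)
    (v : 'rV[R]_3) : Prop :=
  (fun s => (s - t)^-1 *: (c s - c t)) @ within `[0, T[ (t^') --> v.

(* [x z t] is the position at time [t] of the point [z]; only the values for
   [z] in the sphere and [t] in [0, T) matter. *)
Definition flow_solution (F : R -> R -> R) (T : R) (x0 : 'rV[R]_3 -> 'rV[R]_3)
    (x : 'rV[R]_3 -> R -> 'rV[R]_3) : Prop :=
  [/\ smooth_on (S2 `*` `[0, T[) (fun p : 'rV[R]_3 * R => x p.1 p.2),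
      forall t : R, t \in `[0, T[ -> immersion (x^~ t) /\ strictly_convex (x^~ t),
      forall z, S2 z -> x z 0 = x0 z
    & forall z (t : R) n k1 k2, S2 z -> t \in `[0, T[ ->
        outward_unit_normal (x^~ t) z n ->
        principal_curvatures (x^~ t) z n k1 k2 ->
        has_time_derivative T (x z) t (- F k1 k2 *: n)].

End Surfaces.

(* Main.v *)
Require Import Defs.
From HB Require Import structures.
From mathcomp Require Import all_boot all_order all_algebra.
From mathcomp Require Import all_classical all_reals all_analysis.
Import Order.TTheory GRing.Theory Num.Theory.
Import numFieldNormedType.Exports.
Local Open Scope classical_set_scope.
Local Open Scope ring_scope.
Set Implicit Arguments.
Unset Strict Implicit.
Unset Printing Implicit Defensive.
From mathcomp Require Import ring lra.

(** The surface is a closed convex surface of revolution parametrized by its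
Gauss map, [x0 z = (w(u) z1, w(u) z2, Z(u))] with [u = z3], where [z] itself is
the outward normal at [x0 z].  With [w' = u c] and [Z' = rho], where
[rho = w - (1 - u^2) c], the radii of curvature at [x0 z] are [w] (along the
parallel) and [rho] (along the meridian), so the ratio of the principal
curvatures is [w / rho].  A smooth bump function yields a profile for which
this ratio lies between 1 and [r1] and is constantly [r1] for [u] near a prescribed
latitude [u0] (lemma [profile_exists]); the surface is then a smooth embedding,
is strictly convex and has pinching ratio [r1] (lemmas
[smooth_embedding_revolution], [strictly_convex_revolution] and
[pinching_ratio_revolution]).

On the plateau homogeneity gives [F (1/w) (1/rho) = F 1 r1 * w ^ -alpha], so that
a speed enters the initial velocity near the latitude [u0] only through the
constant [F 1 r1], which is positive.  Let [H = k1 + k2] and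
[K = k1 k2].  The quantity
[H^2 - (r1 + 2 + 1/r1) K = (k2 - r1 k1) (k2 - k1 / r1)]
vanishes on the plateau, and it is positive exactly where the ratio of the
curvatures exceeds [r1].  It is a function of the derivatives of order at most
2 of the position, and their time derivatives at [t = 0] are the space
derivatives of the initial velocity.  At the point [z0 = (s, 0, u0)] its time
derivative turns out to be a positive multiple of
[alpha q (alpha m + m - 2) - (alpha - 1)], where [m = 1 - 1/r1] and
[q = u0^2 / s^2] (lemma [gap_algebra]).  The assumption
[r1 > 1 + 2 / (alpha - 1)] says that [alpha m + m - 2 > 0]; hence the derivative
is positive as soon as the latitude [u0] is close enough to the pole (lemma
[latitude_exists]), and then the ratio at [z0] exceeds [r1] for all small
[t > 0] (lemma [flow_pinching]).

Curvatures are compared in a fixed frame.  Every map on the sphere is extended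
to be constant on rays from the origin: the coordinate derivatives in the
definitions are then directional derivatives of the extension (lemmas [dxE] and
[ddxE]), and [pinch_gap] expresses the quantity above, up to a positive factor,
by these derivatives in any tangent frame (lemma [pinching_from_frame]). *)

(** * Maps of class C^k *)

Section CkCalculus.
Context {R : realType}.

Lemma near_eq_differentiable (V W : normedModType R) (f g : V -> W) p :
  (\near p, f p = g p) -> differentiable f p -> differentiable g p.
Proof.
move=> fg df; have dc := diff_continuous df.
have fgp : f p = g p := nbhs_singleton fg.
have E : g \o shift p = cst (g p) + 'd f p +o_ 0 id.
  apply/eqaddoP => e e0.
  have /eqaddoP/(_ _ e0) fe := diff_locally df.
  have fg0 : \forall h \near (0 : V), f (h + p) = g (h + p).
    by move: fg; rewrite (near_shift 0)/= subr0.
  near=> h.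
  have -> : (g \o shift p - (cst (g p) + 'd f p)) h =
            (f \o shift p - (cst (f p) + 'd f p)) h.
    rewrite /= !fctE fgp; congr (_ - _); apply/esym; near: h; exact: fg0.
  by near: h; exact: fe.
by apply/diff_locallyP; rewrite (diff_unique dc E).
Unshelve. all: by end_near. Qed.

Section General.
Context {V W : normedModType R}.
Implicit Types (U : set V) (f g : V -> W) (k : nat).

Lemma Ck_ext k U f g : open U -> (forall p, U p -> f p = g p) ->
  Ck k U f -> Ck k U g.
Proof.
move=> oU; have near_U p : U p -> \forall q \near p, U q by move=> Up; apply: open_nbhs_nbhs; split.
elim: k f g => [|k IH] f g fg.
  move=> cf p Up; suff : g @ p --> g p by [].
  rewrite -(fg p Up); apply: cvg_trans (cf p Up).
  by apply: near_eq_cvg; near=> q; apply: fg; near: q; exact: near_U.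
move=> [df Df]; split.
  move=> p Up; apply: (near_eq_differentiable _ (df p Up)).
  by near=> q; apply: fg; near: q; exact: near_U.
move=> v; apply: (IH _ _ _ (Df v)) => p Up.
apply: near_eq_derive; near=> q; apply: fg; near: q; exact: near_U.
Unshelve. all: by end_near. Qed.

Lemma CkW k U f : Ck k.+1 U f -> Ck k U f.
Proof.
elim: k f => [|k IH] f [df Df].
  by move=> p Up; apply: differentiable_continuous; exact: df.
by split => // v; apply: IH; exact: Df.
Qed.

Lemma Ck_sub k U U' f : U' `<=` U -> Ck k U f -> Ck k U' f.
Proof.
move=> sU; elim: k f => [|k IH] f /=; first by move=> cf p /sU; exact: cf.
by move=> [df Df]; split => [p /sU|v]; [exact: df|exact: IH].
Qed.

Lemma Ck_cup k U U' f : Ck k U f -> Ck k U' f -> Ck k (U `|` U') f.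
Proof.
elim: k f => [|k IH] f /=; first by move=> cf cf' p [/cf|/cf'].
by move=> [df Df] [df' Df']; split => [p [/df|/df']|v] //; exact: IH.
Qed.

Lemma Ck_cst k U (c : W) : Ck k U (cst c).
Proof.
elim: k c => [|k IH] c /=; first by move=> p _; exact: cvg_cst.
split=> [p _|v]; first exact: differentiable_cst.
by rewrite (_ : 'D_v (cst c) = cst 0)//; apply/funext => p; rewrite derive_cst.
Qed.

Lemma Ck_lin k U (f : {linear V -> W}) : continuous f -> Ck k U f.
Proof.
case: k => [|k] cf /=; first by move=> p _; exact: cf.
split=> [p _|v]; first exact: linear_differentiable.
rewrite (_ : 'D_v f = cst (f v)); first exact: Ck_cst.
apply/funext => p; rewrite deriveE; last exact: linear_differentiable.
by rewrite diff_lin.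
Qed.

Lemma Ck_differentiable k U f p : U p -> Ck k.+1 U f -> differentiable f p.
Proof. by move=> Up [df _]; exact: df. Qed.

Lemma Ck_derive k U f v : Ck k.+1 U f -> Ck k U ('D_v f).
Proof. by move=> [_]; exact. Qed.

Lemma Ck_continuous k U f p : U p -> Ck k U f -> {for p, continuous f}.
Proof.
case: k => [|k] Up /=; first exact.
by move=> [df _]; apply: differentiable_continuous; exact: df.
Qed.

Lemma CkD k U f g : open U -> Ck k U f -> Ck k U g -> Ck k U (f \+ g).
Proof.
move=> oU; elim: k f g => [|k IH] f g /=.
  by move=> cf cg p Up; apply: cvgD; [exact: cf|exact: cg].
move=> [df Df] [dg Dg]; split=> [p Up|v].
  by apply: differentiableD; [exact: df|exact: dg].
apply: (@Ck_ext _ _ ('D_v f \+ 'D_v g)) => //; last exact: IH.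
move=> p Up; rewrite (_ : f \+ g = f + g)// deriveD//.
  by apply: diff_derivable; exact: df.
by apply: diff_derivable; exact: dg.
Qed.

Lemma Ck_sum k U n (f : 'I_n -> V -> W) : open U ->
  (forall i, Ck k U (f i)) -> Ck k U (fun p => \sum_(i < n) f i p).
Proof.
move=> oU; elim: n f => [|n IH] f Cf.
  apply: (@Ck_ext _ _ (cst 0)) => //; last exact: Ck_cst.
  by move=> p _; rewrite big_ord0.
apply: (@Ck_ext _ _ ((fun p => \sum_(i < n) f (widen_ord (leqnSn n) i) p)
   \+ f ord_max)) => //.
  by move=> p _; rewrite big_ord_recr.
by apply: CkD => //; apply: IH.
Qed.

End General.

Section Scalar.
Context {V : normedModType R}.
Implicit Types (U : set V) (f g : V -> R) (k : nat).

Lemma CkM k U f g : open U -> Ck k U f -> Ck k U g ->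
  Ck k U (fun p => f p * g p).
Proof.
move=> oU; elim: k f g => [|k IH] f g.
  by move=> cf cg p Up; apply: cvgM; [exact: cf|exact: cg].
move=> Cf Cg; have [df Df] := Cf; have [dg Dg] := Cg; split=> [p Up|v].
  by apply: differentiableM; [exact: df|exact: dg].
apply: (@Ck_ext _ _ _ _ ((fun p => f p * 'D_v g p) \+ (fun p => g p * 'D_v f p))) => //.
  move=> p Up; rewrite (_ : (fun p => f p * g p) = f * g)// deriveM//.
    by apply: diff_derivable; exact: df.
  by apply: diff_derivable; exact: dg.
by apply: CkD => //; apply: IH; do ?[exact: CkW | exact: Dg | exact: Df].
Qed.

Lemma CkN k U f : open U -> Ck k U f -> Ck k U (fun p => - f p).
Proof.
move=> oU Cf; apply: (@Ck_ext _ _ _ _ (fun p => cst (-1) p * f p)) => //.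
  by move=> p _; rewrite mulN1r.
by apply: CkM => //; exact: Ck_cst.
Qed.

Lemma CkB k U f g : open U -> Ck k U f -> Ck k U g ->
  Ck k U (fun p => f p - g p).
Proof. by move=> oU Cf Cg; apply: (CkD oU Cf (CkN oU Cg)). Qed.

Lemma CkV k U f : open U -> (forall p, U p -> f p != 0) ->
  Ck k U f -> Ck k U (fun p => (f p)^-1).
Proof.
move=> oU f0; elim: k => [|k IH].
  by move=> cf p Up; apply: cvgV; [exact: f0|exact: cf].
move=> Cf; have [df Df] := Cf; have CV := IH (CkW Cf); split=> [p Up|v].
  by apply: (differentiableV (df p Up)); exact: f0.
apply: (@Ck_ext _ _ _ _ (fun p => - ((f p)^-1 * (f p)^-1 * 'D_v f p))) => //.
  move=> p Up; rewrite [RHS](@deriveV _ _ f) ?f0//; last first.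
    by apply: diff_derivable; exact: df.
  by rewrite /GRing.scale/= expr2 invfM mulNr.
apply: CkN => //.
have CVV := CkM oU CV CV.
have CVVD := CkM oU CVV (Df v).
exact: CVVD.
Qed.

End Scalar.

(** The chain rule is stated for inner maps given by their coordinates in a
finite family of vectors [e].  The derivatives of [g \o comb a] are then sums
of products of scalar functions of the same form, which is what the induction on
the order of differentiability needs. *)
Section Comp.
Context {V V' : normedModType R} {n : nat} (e : 'I_n -> V').
Implicit Types (a : 'I_n -> V -> R).

Let comb a p := \sum_(i < n) a i p *: e i.

Lemma differentiable_comb a p : (forall i, differentiable (a i) p) ->
  differentiable (comb a) p.
Proof.
move=> da; rewrite (_ : comb a = \sum_(i < n) (fun p => a i p *: e i)).
  by apply: differentiable_sum => i; exact: differentiableZl.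
by apply/funext => q; rewrite /comb fct_sumE.
Qed.

Lemma derive_comb a p v : (forall i, differentiable (a i) p) ->
  'D_v (comb a) p = \sum_(i < n) 'D_v (a i) p *: e i.
Proof.
move=> da; rewrite (_ : comb a = \sum_(i < n) (fun p => a i p *: e i)); last first.
  by apply/funext => q; rewrite /comb fct_sumE.
rewrite derive_sum; last first.
  by move=> i; apply: diff_derivable; exact: differentiableZl.
apply: eq_bigr => i _; rewrite deriveE; last exact: differentiableZl.
by rewrite diffZl//= -deriveE.
Qed.

Lemma derive_comp_comb (g : V' -> R) a p v : (forall i, differentiable (a i) p) ->
  differentiable g (comb a p) ->
  'D_v (g \o comb a) p = \sum_(i < n) 'D_v (a i) p * 'D_(e i) g (comb a p).
Proof.
move=> da dg; have dc := differentiable_comb da.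
rewrite deriveE; last exact: differentiable_comp.
rewrite (diff_comp dc dg)/= -(deriveE v dc) (derive_comb _ da) linear_sum; apply: eq_bigr => i _.
by rewrite linearZ/= -deriveE.
Qed.

Lemma Ck_comp k U U' (g : V' -> R) a : open U ->
  (forall i, Ck k U (a i)) -> (forall p, U p -> U' (comb a p)) ->
  Ck k U' g -> Ck k U (g \o comb a).
Proof.
move=> oU; elim: k g a => [|k IH] g a Ca aU Cg.
  move=> p Up; apply: continuous_comp; last by apply: Cg; exact: aU.
  apply: (@Ck_sum _ _ 0 U n (fun i p => a i p *: e i) oU) => // i q Uq.
  by apply: cvgZr_tmp; exact: Ca.
have [dg Dg] := Cg; split=> [p Up|v].
  apply: differentiable_comp; last by apply: dg; exact: aU.
  by apply: differentiable_comb => i; have [+ _] := Ca i; exact.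
apply: (@Ck_ext _ _ _ _ (fun p => \sum_(i < n) 'D_v (a i) p *
   ('D_(e i) g \o comb a) p)) => //.
  move=> p Up; rewrite derive_comp_comb//; last by apply: dg; exact: aU.
  by move=> i; have [+ _] := Ca i; exact.
apply: Ck_sum => // i; apply: CkM => //; first exact: (Ck_derive _ (Ca i)).
by apply: IH => // [j|]; [exact: CkW|exact: Dg].
Qed.

End Comp.

Section Rows.
Context {V : normedModType R} {n : nat}.

Lemma rV_comb (u : 'rV[R]_n.+1) : u = \sum_(i < n.+1) u 0 i *: delta_mx 0 i.
Proof. exact: row_sum_delta. Qed.

Lemma differentiable_rV (f : V -> 'rV[R]_n.+1) p :
  (forall i, differentiable (fun q => f q 0 i) p) -> differentiable f p.
Proof.
move=> df; have := differentiable_comb (fun i => delta_mx 0 i : 'rV[R]_n.+1) df.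
by congr (differentiable _ p); apply/funext => q; rewrite -rV_comb.
Qed.

Lemma Ck_rV k U (f : V -> 'rV[R]_n.+1) : open U ->
  (forall i, Ck k U (fun q => f q 0 i)) -> Ck k U f.
Proof.
move=> oU; elim: k f => [|k IH] f Cf.
  move=> p Up; rewrite (_ : f = fun q => \sum_(i < n.+1) f q 0 i *: delta_mx 0 i); last first.
    by apply/funext => q; rewrite -rV_comb.
  apply: (@Ck_sum _ _ 0 U n.+1 (fun i q => f q 0 i *: delta_mx 0 i) oU) => // i q Uq.
  by apply: cvgZr_tmp; exact: Cf.
have df p : U p -> differentiable f p.
  by move=> Up; apply: differentiable_rV => i; have [+ _] := Cf i; exact.
split=> // v; apply: IH => i; apply: Ck_ext (Ck_derive v (Cf i)) => // p Up.
by rewrite derive_mx ?mxE//; apply: diff_derivable; exact: df.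
Qed.

Lemma Ck_coord k U (f : V -> 'rV[R]_n.+1) i : open U ->
  Ck k U f -> Ck k U (fun q => f q 0 i).
Proof.
move=> oU; elim: k f => [|k IH] f.
  move=> Cf p Up; apply: (@continuous_comp _ _ _ f (fun u : 'rV[R]_n.+1 => u 0 i)).
    exact: Cf.
  exact: coord_continuous.
move=> [df Df]; split=> [p Up|v].
  apply: (@differentiable_comp _ _ _ _ f (fun u : 'rV[R]_n.+1 => u 0 i)); first exact: df.
  exact: differentiable_coord.
apply: (@Ck_ext _ _ _ _ (fun q => 'D_v f q 0 i)) => //; last exact: (IH _ (Df v)).
by move=> p Up; rewrite derive_mx ?mxE//; apply: diff_derivable; exact: df.
Qed.

End Rows.

End CkCalculus.

(** * Directional derivatives of real functions *)

Section DeriveRules.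
Context {R : realType} {V : normedModType R}.
Implicit Types (f g : V -> R) (p v : V) (a b : R).

Lemma derD f g p v a b : is_derive p v f a -> is_derive p v g b ->
  is_derive p v (fun q => f q + g q) (a + b).
Proof. by move=> fa gb; exact: is_deriveD. Qed.

Lemma derN f p v a : is_derive p v f a -> is_derive p v (fun q => - f q) (- a).
Proof. by move=> fa; exact: is_deriveN. Qed.

Lemma derB f g p v a b : is_derive p v f a -> is_derive p v g b ->
  is_derive p v (fun q => f q - g q) (a - b).
Proof. by move=> fa gb; exact: is_deriveB. Qed.

Lemma derM f g p v a b : is_derive p v f a -> is_derive p v g b ->
  is_derive p v (fun q => f q * g q) (a * g p + f p * b).
Proof.
move=> fa gb; have D := is_deriveM fa gb; apply: (is_derive_eq D).
by rewrite addrC /GRing.scale/= [a * _]mulrC.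
Qed.

Lemma derC p v (c : R) : is_derive p v (fun=> c) (0 : R).
Proof. exact: is_derive_cst. Qed.

Lemma der_line f p v a :
  is_derive (0 : R) 1 (fun s => f (s *: v + p)) a <-> is_derive p v f a.
Proof.
have E : 'D_1 (fun s : R => f (s *: v + p)) 0 = 'D_v f p.
  have limE (F G : R -> R) : F =1 G -> lim (F @ 0^') = lim (G @ 0^') by move=> /funext ->.
  apply: limE => h /=.
  by rewrite addr0 scale0r add0r [h *: 1]mulr1.
split=> -[d e].
  by apply: (DeriveDef (iffRL (derivable1P _ _ _) d)); rewrite -e E.
by apply: (DeriveDef (iffLR (derivable1P _ _ _) d)); rewrite -e -E.
Qed.

Lemma der_comp1 (g : R -> R) f p v a b : is_derive (f p) 1 g b ->
  is_derive p v f a -> is_derive p v (fun q => g (f q)) (b * a).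
Proof.
move=> gb /der_line fa; apply/der_line.
by apply: (@is_derive1_comp _ g (fun s => f (s *: v + p)) 0) => //; rewrite scale0r add0r.
Qed.

Lemma derV f p v a : f p != 0 -> is_derive p v f a ->
  is_derive p v (fun q => (f q)^-1) (- (f p ^- 2 * a)).
Proof.
move=> fp0 [df <-]; apply: DeriveDef; first exact: derivableV.
by rewrite (@deriveV _ _ f) ?f0// /GRing.scale/= mulNr.
Qed.

Lemma derX f n p v a : is_derive p v f a ->
  is_derive p v (fun q => f q ^+ n) (n%:R * f p ^+ n.-1 * a).
Proof.
move=> fa; have D := is_deriveX n fa.
rewrite (_ : (fun q => f q ^+ n) = f ^+ n); last by apply/funext => q; rewrite fctE.
by apply: (is_derive_eq D); rewrite /GRing.scale/= mulr_natl.
Qed.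

Lemma der_expR f p v a : is_derive p v f a ->
  is_derive p v (fun q => expR (f q)) (expR (f p) * a).
Proof. by move=> fa; exact: (der_comp1 (is_derive_expR (f p)) fa). Qed.

End DeriveRules.

Lemma derId {R : realType} (x : R) : is_derive x 1 (fun y : R => y) 1.
Proof. exact: is_derive_id. Qed.

(** * A smooth step function, and primitives *)

Section OneVariable.
Context {R : realType}.
Implicit Types (f g h : R -> R) (U : set R) (k : nat).

Lemma Ck_comp1 (V : normedModType R) k (U : set V) (U' : set R) (f : V -> R) g :
  open U -> Ck k U f -> (forall p, U p -> U' (f p)) -> Ck k U' g ->
  Ck k U (fun p => g (f p)).
Proof.
move=> oU Cf fU Cg.
have := @Ck_comp R V R 1 (fun=> 1) k U U' g (fun=> f) oU (fun=> Cf) _ Cg.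
have combE p : \sum_(i < 1) f p *: (1 : R : normedModType R) = f p.
  by rewrite big_ord1 /GRing.scale/= mulr1.
move=> /(_ _)/Ck_ext; apply => //.
  by move=> p _ /=; rewrite combE.
by move=> p Up; rewrite combE; exact: fU.
Qed.

(** In one variable every directional derivative is a multiple of the ordinary
one. *)
Lemma Ck_primitive k U f h : open U -> Ck k U h ->
  (forall u, U u -> is_derive u 1 f (h u)) -> Ck k.+1 U f.
Proof.
move=> oU Ch fh.
have df u : U u -> differentiable f u.
  by move=> Uu; apply/derivable1_diffP; have [] := fh u Uu.
split => // v; apply: (@Ck_ext _ _ _ _ _ (fun u => cst v u * h u)) => //.
  move=> u Uu; have [dfu fhu] := fh u Uu.
  rewrite deriveE; last exact: df.
  by rewrite diff1E; [rewrite derive1E fhu|exact: df].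
by apply: CkM => //; exact: Ck_cst.
Qed.

Lemma Ck_expR k : Ck k setT (@expR R).
Proof.
elim: k => [|k IH]; first by move=> u _; exact: continuous_expR.
by apply: (Ck_primitive openT IH).
Qed.

(** The derivatives of [exp (- 1 / x)] are combinations of these functions, so
that smoothness at 0 reduces to one estimate for the whole family. *)
Definition flat_exp (n : nat) (x : R) : R :=
  if 0 < x then x^-1 ^+ n * expR (- x^-1) else 0.

(** The term of degree [n + 1] of the exponential series bounds [expR (1 / x)]
from below. *)
Lemma flat_exp_le n x : `|flat_exp n x| <= n.+1`!%:R * `|x|.
Proof.
rewrite /flat_exp; case: ifPn => [x0|_]; last by rewrite normr0 mulr_ge0.
have xi0 : 0 < x^-1 by rewrite invr_gt0.
rewrite ger0_norm; last by rewrite mulr_ge0 ?expR_ge0 ?exprn_ge0 ?ltW.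
rewrite gtr0_norm// expRN ler_pdivrMr ?expR_gt0//.
have := @expR_ge1Dxn R x^-1 n (ltW xi0) => H.
have {}H : x^-1 ^+ n.+1 / n.+1`!%:R <= expR x^-1 by apply: le_trans H; rewrite lerDr.
have f0 : (0 : R) < n.+1`!%:R by rewrite ltr0n fact_gt0.
rewrite -(ler_pM2l (mulr_gt0 f0 x0)) in H.
apply: le_trans H; rewrite exprS.
by rewrite le_eqVlt; apply/orP; left; apply/eqP; field; rewrite !gt_eqF.
Qed.

(** At 0 the difference quotient of [flat_exp n] is [flat_exp n.+1], which tends
to 0. *)
Lemma is_derive_flat_exp n (x : R) :
  is_derive x 1 (flat_exp n) (flat_exp n.+2 x - n%:R * flat_exp n.+1 x).
Proof.
have [x0|x0|x0] := ltgtP x 0.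
- apply: (@near_eq_is_derive _ _ _ (cst 0)).
    near=> y; rewrite /flat_exp ifF//; apply/negbTE; rewrite -leNgt ltW//.
    by near: y; exact: lt_nbhsl.
  by rewrite /flat_exp !ifF ?(lt_gtF x0)// mulr0 subr0; exact: is_derive_cst.
- have xn0 : x != 0 by rewrite gt_eqF.
  have dV := derV xn0 (derId x).
  have dM : is_derive x 1 (fun y : R => y^-1 ^+ n * expR (- y^-1))
      (flat_exp n.+2 x - n%:R * flat_exp n.+1 x).
    apply: (is_derive_eq (derM (derX n dV) (der_expR (derN dV)))).
    rewrite /flat_exp x0 -exprVn; case: n => [|n] /=; last by rewrite !exprS expr0; ring.
    by rewrite !exprS expr0; ring.
  apply: near_eq_is_derive dM.
  near=> y; rewrite /flat_exp ifT//.
  by near: y; exact: lt_nbhsr.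
- rewrite x0; have e0 m : flat_exp m 0 = 0 by rewrite /flat_exp ltxx.
  rewrite !e0 mulr0 subr0.
  have cv : (fun h : R => h^-1 *: ((flat_exp n \o shift 0) (h *: 1) - flat_exp n 0)) @ 0^' --> (0:R).
    apply/cvgrPdist_le => e e_gt0.
    have f0 : (0 : R) < n.+2`!%:R by rewrite ltr0n fact_gt0.
    near=> h.
    have hn0 : h != 0 by near: h; exact: nbhs_dnbhs_neq.
    rewrite /= e0 subr0 addr0 sub0r normrN {1}/GRing.scale/= [h *: 1]mulr1.
    have -> : h^-1 * flat_exp n h = flat_exp n.+1 h.
      by rewrite /flat_exp; case: ifP => _; rewrite ?mulr0// exprS mulrA.
    apply: le_trans (flat_exp_le _ _) _.
    rewrite mulrC -ler_pdivlMr//.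
    by near: h; apply: dnbhs0_le; rewrite divr_gt0.
  by apply: DeriveDef; [apply/cvg_ex; exists 0|apply/cvg_lim].
Unshelve. all: by end_near. Qed.

Lemma Ck_flat_exp k n : Ck k setT (flat_exp n).
Proof.
elim: k n => [|k IH] n.
  move=> x _; apply: differentiable_continuous; apply/derivable1_diffP.
  by have [] := is_derive_flat_exp n x.
apply: (@Ck_primitive _ _ _ (fun x => flat_exp n.+2 x - cst n%:R x * flat_exp n.+1 x)).
- exact: openT.
- by apply: (CkB openT (IH _)); apply: (CkM openT _ (IH _)); exact: Ck_cst.
- by move=> x _; exact: is_derive_flat_exp.
Qed.

Definition smooth_step (x : R) : R :=
  flat_exp 0 x / (flat_exp 0 x + flat_exp 0 (1 - x)).

Lemma flat_exp_ge0 n x : 0 <= flat_exp n x.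
Proof.
rewrite /flat_exp; case: ifP => // x0.
by rewrite mulr_ge0 ?expR_ge0 ?exprn_ge0 ?invr_ge0 ?ltW.
Qed.

Lemma flat_exp_gt0 n x : 0 < x -> 0 < flat_exp n x.
Proof.
by move=> x0; rewrite /flat_exp x0 mulr_gt0 ?expR_gt0 ?exprn_gt0 ?invr_gt0.
Qed.

Lemma smooth_step_den x : 0 < flat_exp 0 x + flat_exp 0 (1 - x).
Proof.
have [x0|x0] := ltP 0 x.
  by rewrite ltr_wpDr ?flat_exp_ge0 ?flat_exp_gt0.
by rewrite ltr_wpDl ?flat_exp_ge0 ?flat_exp_gt0// subr_gt0 (le_lt_trans x0).
Qed.

Lemma Ck_smooth_step k : Ck k setT smooth_step.
Proof.
have C1 : Ck k setT (fun x : R => 1 - x).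
  have Cid : Ck k setT (fun x : R => x).
    by apply: (@Ck_lin R R R k setT idfun) => x; exact: cvg_id.
  by apply: (CkB openT (f := cst 1) _ Cid); exact: Ck_cst.
apply: CkM; [exact: openT|exact: Ck_flat_exp|].
apply: CkV; [exact: openT|by move=> x _; rewrite gt_eqF// smooth_step_den|].
apply: CkD; [exact: openT|exact: Ck_flat_exp|].
by apply: (Ck_comp1 openT C1 _ (Ck_flat_exp _ _)).
Qed.

Lemma smooth_step_ge0 x : 0 <= smooth_step x.
Proof. by rewrite divr_ge0 ?flat_exp_ge0// ltW// smooth_step_den. Qed.

Lemma smooth_step_le1 x : smooth_step x <= 1.
Proof. by rewrite ler_pdivrMr ?smooth_step_den// mul1r lerDl flat_exp_ge0. Qed.

Lemma smooth_step0 x : x <= 0 -> smooth_step x = 0.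
Proof. by move=> x0; rewrite /smooth_step /flat_exp ltNge x0 mul0r. Qed.

Lemma smooth_step1 x : 1 <= x -> smooth_step x = 1.
Proof.
move=> x1; rewrite /smooth_step [X in _ + X]/flat_exp subr_gt0 ltNge x1/= addr0.
by rewrite divff// gt_eqF// flat_exp_gt0// (lt_le_trans ltr01).
Qed.

Lemma primitive_exists h (a b : R) : a < b -> {in `[a, b], continuous h} ->
  exists f, forall u, a < u < b -> is_derive u 1 f (h u).
Proof.
move=> ab ch; exists (fun x => \int[lebesgue_measure]_(t in `[a, x]) h t)%R.
move=> u /andP[au ub].
have ih : (@lebesgue_measure R).-integrable `[a, b] (EFin \o h).
  apply: continuous_compact_integrable; first exact: segment_compact.
  by apply: continuous_in_subspaceT => x; rewrite inE/= => xab; exact: ch.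
have [|df f'] := @continuous_FTC1_closed _ h a u b ub ih au.
  by apply: ch; rewrite in_itv/= !ltW.
by apply: (DeriveDef df); rewrite -derive1E.
Qed.

End OneVariable.

(** * Vectors of the Euclidean space *)

Section Space.
Context {R : realType}.
Implicit Types (u v w n : 'rV[R]_3).

Definition o0 : 'I_3 := Ordinal (isT : 0 < 3)%N.
Definition o1 : 'I_3 := Ordinal (isT : 1 < 3)%N.
Definition o2 : 'I_3 := Ordinal (isT : 2 < 3)%N.

Lemma sum3 (W : nmodType) (F : 'I_3 -> W) : \sum_i F i = F o0 + F o1 + F o2.
Proof.
rewrite !big_ord_recl big_ord0 addr0 addrA.
by congr (_ + _ + _); congr F; exact: val_inj.
Qed.

Lemma forall_I3 (P : 'I_3 -> Prop) : P o0 -> P o1 -> P o2 -> forall i, P i.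
Proof.
move=> P0 P1 P2 [[|[|[|//]]] i3].
- by rewrite (_ : Ordinal _ = o0)//; exact: val_inj.
- by rewrite (_ : Ordinal _ = o1)//; exact: val_inj.
- by rewrite (_ : Ordinal _ = o2)//; exact: val_inj.
Qed.

Lemma rV3_eq u v : u 0 o0 = v 0 o0 -> u 0 o1 = v 0 o1 -> u 0 o2 = v 0 o2 -> u = v.
Proof. by move=> *; apply/rowP; exact: forall_I3. Qed.

Definition vec3 (a b c : R) : 'rV[R]_3 := \row_i [:: a; b; c]`_i.

Lemma vec3E a b c : (vec3 a b c 0 o0 = a) * (vec3 a b c 0 o1 = b) * (vec3 a b c 0 o2 = c).
Proof. by rewrite !mxE. Qed.

Lemma dotE u v : dot u v = u 0 o0 * v 0 o0 + u 0 o1 * v 0 o1 + u 0 o2 * v 0 o2.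
Proof. by rewrite /dot mxE sum3 !mxE. Qed.

Lemma dotC u v : dot u v = dot v u.
Proof. by rewrite !dotE; ring. Qed.

Lemma dotDl u v w : dot (u + v) w = dot u w + dot v w.
Proof. by rewrite !dotE !mxE; ring. Qed.

Lemma dotZl a u v : dot (a *: u) v = a * dot u v.
Proof. by rewrite !dotE !mxE; ring. Qed.

Lemma dotNl u v : dot (- u) v = - dot u v.
Proof. by rewrite !dotE !mxE; ring. Qed.

Lemma dotDr u v w : dot w (u + v) = dot w u + dot w v.
Proof. by rewrite !(dotC w) dotDl. Qed.

Lemma dotZr a u v : dot v (a *: u) = a * dot v u.
Proof. by rewrite !(dotC v) dotZl. Qed.

Lemma dotNr u v : dot v (- u) = - dot v u.
Proof. by rewrite !(dotC v) dotNl. Qed.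

Lemma dot_ge0 u : 0 <= dot u u.
Proof. by rewrite dotE -!expr2 !addr_ge0 ?sqr_ge0. Qed.

Lemma dot_eq0 u : dot u u = 0 -> u = 0.
Proof.
rewrite dotE -!expr2 => /eqP; rewrite !paddr_eq0 ?addr_ge0 ?sqr_ge0// !sqrf_eq0.
by move=> /andP[/andP[/eqP u0 /eqP u1] /eqP u2]; apply: rV3_eq; rewrite !mxE.
Qed.

Lemma dot_gt0 u : u != 0 -> 0 < dot u u.
Proof.
by move=> u0; rewrite lt_neqAle dot_ge0 andbT eq_sym; apply: contraNneq u0 => /dot_eq0 ->.
Qed.

Lemma dot_suml (I : finType) (F : I -> 'rV[R]_3) v :
  dot (\sum_i F i) v = \sum_i dot (F i) v.
Proof.
apply: (big_morph (fun u => dot u v)); first by move=> x y; exact: dotDl.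
by rewrite dotE !mxE; ring.
Qed.

Lemma dot_sumr (I : finType) (F : I -> 'rV[R]_3) v :
  dot v (\sum_i F i) = \sum_i dot v (F i).
Proof. by rewrite dotC dot_suml; apply: eq_bigr => i _; rewrite dotC. Qed.

Lemma mulmx_dot m k (A : 'M[R]_(m, 3)) (B : 'M[R]_(k, 3)) :
  A *m B^T = \matrix_(i, j) dot (row i A) (row j B).
Proof.
by apply/matrixP => i j; rewrite !mxE /dot mxE; apply: eq_bigr => l _; rewrite !mxE.
Qed.

Definition cross u v : 'rV[R]_3 :=
  vec3 (u 0 o1 * v 0 o2 - u 0 o2 * v 0 o1)
       (u 0 o2 * v 0 o0 - u 0 o0 * v 0 o2)
       (u 0 o0 * v 0 o1 - u 0 o1 * v 0 o0).

(** In dimension 3 a vector orthogonal to two vectors that span the orthogonal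
plane of [n] is a multiple of [n]; written as an identity, this holds for
dependent vectors too. *)
Lemma cross_normal u v n : dot n n = 1 -> dot u n = 0 -> dot v n = 0 ->
  cross u v = dot (cross u v) n *: n.
Proof.
move=> nn un vn.
have H : dot n n *: cross u v - dot (cross u v) n *: n =
  dot u n *: cross n v - dot v n *: cross n u.
  by apply: rV3_eq; rewrite !dotE !mxE/= ?mxE/=; ring.
by apply/eqP; rewrite -subr_eq0 -[X in X - _]scale1r -nn H un vn !scale0r subrr.
Qed.

Lemma cross_gram u v : dot (cross u v) (cross u v) =
  dot u u * dot v v - dot u v * dot v u.
Proof. by rewrite !dotE !vec3E; ring. Qed.

Definition radial (p : 'rV[R]_3) : 'rV[R]_3 := (euclid_norm p)^-1 *: p.

Lemma radial_S2 p : p != 0 -> S2 (radial p).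
Proof.
move=> p0; rewrite /S2/= /radial dotZl dotZr /euclid_norm.
have d0 := dot_gt0 p0.
rewrite mulrA -expr2 exprVn sqr_sqrtr ?ltW//.
by rewrite mulVf// gt_eqF.
Qed.

Lemma radial_id z : S2 z -> radial z = z.
Proof. by move=> zS; rewrite /radial /euclid_norm zS sqrtr1 invr1 scale1r. Qed.

Lemma S2_neq0 (z : 'rV[R]_3) : S2 z -> z != 0.
Proof.
move=> zS; apply/eqP => z0; move: zS; rewrite /S2/= z0 dotE !mxE => /eqP.
by rewrite !mul0r !addr0 eq_sym oner_eq0.
Qed.

(** The extension of a map on the sphere that is constant on rays from the
origin.  Its derivatives at a point of the sphere replace the coordinate
derivatives in the charts. *)
Definition ray_ext (x : 'rV[R]_3 -> 'rV[R]_3) p := x (radial p).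

End Space.

(** * Principal curvatures in an arbitrary tangent frame *)

Section Frames.
Context {R : realType}.
Implicit Types (x : 'rV[R]_3 -> 'rV[R]_3) (z n : 'rV[R]_3) (E : 'M[R]_(2, 3)).

Lemma derive_affine m k (W : normedModType R) (h : 'rV[R]_k.+1 -> W) (z : 'rV[R]_k.+1)
    (E : 'M[R]_(m.+1, k.+1)) (a v : 'rV[R]_m.+1) :
  'D_v (fun a => h (z + a *m E)) a = 'D_(v *m E) h (z + a *m E).
Proof.
have limE (F G : R -> W) : F =1 G -> lim (F @ 0^') = lim (G @ 0^') by move=> /funext ->.
by apply: limE => t /=; rewrite mulmxDl scalemxAl addrCA.
Qed.

(** [chart z E] is the radial projection composed with the affine map
[a |-> z + a *m E]. *)
Lemma dxE x z E i : dx x z E i = 'D_(row i E) (ray_ext x) z.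
Proof.
rewrite /dx /partial (derive_affine (ray_ext x) z E) -rowE.
by rewrite mul0mx addr0.
Qed.

Lemma ddxE x z E i j : ddx x z E i j = 'D_(row i E) ('D_(row j E) (ray_ext x)) z.
Proof.
rewrite /ddx /partial.
have -> : 'D_(delta_mx 0 j) (x \o chart z E) =
    fun a => 'D_(row j E) (ray_ext x) (z + a *m E).
  by apply/funext => a; rewrite (derive_affine (ray_ext x) z E) -rowE.
by rewrite [LHS](derive_affine ('D_(row j E) (ray_ext x)) z E) -rowE mul0mx addr0.
Qed.

Lemma ray_ext_eq x y : (forall z, S2 z -> x z = y z) ->
  forall p, p != 0 -> ray_ext x p = ray_ext y p.
Proof. by move=> xy p p0; apply: xy; exact: radial_S2. Qed.

Definition C2_at x z := exists U : set 'rV[R]_3,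
  [/\ open U, U z & Ck 2 U (ray_ext x)].

Lemma derive_sum_dir (f : 'rV[R]_3 -> 'rV[R]_3) p m (S : 'I_m -> R) (e : 'I_m -> 'rV[R]_3) :
  differentiable f p ->
  'D_(\sum_k S k *: e k) f p = \sum_k S k *: 'D_(e k) f p.
Proof.
move=> df; rewrite deriveE// linear_sum; apply: eq_bigr => k _.
by rewrite linearZ/= deriveE.
Qed.

Lemma row_mul_sum m k (S : 'M[R]_(m, k)) (E : 'M[R]_(k, 3)) i :
  row i (S *m E) = \sum_l S i l *: row l E.
Proof.
rewrite row_mul mulmx_sum_row; apply: eq_bigr => l _; by rewrite mxE.
Qed.

Lemma dx_change x z (S : 'M[R]_2) E i : C2_at x z ->
  dx x z (S *m E) i = \sum_k S i k *: dx x z E k.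
Proof.
move=> [U [oU Uz [dX _]]]; rewrite dxE row_mul_sum derive_sum_dir; last exact: dX.
by apply: eq_bigr => k _; rewrite dxE.
Qed.

Lemma ddx_change x z (S : 'M[R]_2) E i j : C2_at x z ->
  ddx x z (S *m E) i j = \sum_k \sum_l (S i k * S j l) *: ddx x z E k l.
Proof.
move=> [U [oU Uz [dX DX]]]; rewrite ddxE !row_mul_sum.
have nU : \forall q \near z, U q by apply: open_nbhs_nbhs.
have dDX v : differentiable ('D_v (ray_ext x)) z by have [+ _] := DX v; exact.
have E1 v : 'D_v ('D_(\sum_l S j l *: row l E) (ray_ext x)) z =
   \sum_l S j l *: 'D_v ('D_(row l E) (ray_ext x)) z.
  pose g (l : 'I_2) := S j l \*: 'D_(row l E) (ray_ext x).
  transitivity ('D_v (\sum_l g l) z).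
    apply: near_eq_derive; near=> q; rewrite derive_sum_dir.
      by rewrite fct_sumE.
    by apply: dX; near: q.
  rewrite derive_sum => [|l]; last first.
    by apply: derivableZ; apply: diff_derivable; exact: dDX.
  by apply: eq_bigr => l _; rewrite deriveZ//; apply: diff_derivable; exact: dDX.
rewrite E1 exchange_big/=; apply: eq_bigr => l _.
rewrite derive_sum_dir// scaler_sumr; apply: eq_bigr => k _.
by rewrite scalerA mulrC ddxE.
Unshelve. all: by end_near. Qed.

Lemma form_change (S : 'M[R]_2) (B : 'I_2 -> 'I_2 -> R) :
  \matrix_(i, j) (\sum_k \sum_l S i k * S j l * B k l) =
  S *m (\matrix_(k, l) B k l) *m S^T.
Proof.
apply/matrixP => i j; rewrite !mxE.
rewrite exchange_big/=; apply: eq_bigr => l _; rewrite !mxE mulr_suml.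
by apply: eq_bigr => k _; rewrite !mxE mulrAC.
Qed.

Lemma metric_change x z (S : 'M[R]_2) E : C2_at x z ->
  metric x z (S *m E) = S *m metric x z E *m S^T.
Proof.
move=> Cx; rewrite -form_change//; apply/matrixP => i j; rewrite !mxE !dx_change//.
rewrite dot_suml; apply: eq_bigr => k _; rewrite dot_sumr; apply: eq_bigr => l _.
by rewrite dotZl dotZr mulrA.
Qed.

Lemma second_form_change x z n (S : 'M[R]_2) E : C2_at x z ->
  second_form x z (S *m E) n = S *m second_form x z E n *m S^T.
Proof.
move=> Cx; rewrite -form_change//; apply/matrixP => i j; rewrite !mxE ddx_change//.
rewrite dot_suml -sumrN; apply: eq_bigr => k _.
rewrite dot_suml -sumrN; apply: eq_bigr => l _.
by rewrite dotZl mulrN.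
Qed.

Lemma rank_tangent_plane z : S2 z -> \rank (kermx z^T) = 2%N.
Proof.
by move=> zS; rewrite mxrank_ker mxrank_tr rank_rV (S2_neq0 zS).
Qed.

Lemma sub_tangent_plane z (E : 'M[R]_(2, 3)) : z *m E^T = 0 -> (E <= kermx z^T)%MS.
Proof.
by move=> zE; apply/sub_kermxP; rewrite -[E]trmxK -trmx_mul zE trmx0.
Qed.

Lemma tangent_plane_sub z E : S2 z -> tangent_frame z E -> (kermx z^T <= E)%MS.
Proof.
move=> zS [zE fE]; have [_ <-] := mxrank_leqif_sup (sub_tangent_plane zE).
by rewrite (rank_tangent_plane zS) (eqP fE).
Qed.

(** Both frames are bases of the kernel of [z^T], which has rank 2. *)
Lemma tangent_frame_change z E E' : S2 z -> tangent_frame z E ->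
  tangent_frame z E' -> exists2 S : 'M[R]_2, S \in unitmx & E' = S *m E.
Proof.
move=> zS tE [zE' fE'].
have EE : (E' <= E)%MS.
  exact: submx_trans (sub_tangent_plane zE') (tangent_plane_sub zS tE).
exists (E' *m pinvmx E); last by rewrite mulmxKpV.
rewrite -row_free_unit -row_leq_rank.
have r2 : (2 <= \rank E')%N by rewrite (eqP fE').
by apply: leq_trans r2 _; rewrite -{1}(mulmxKpV EE) mxrankM_maxl.
Qed.

Lemma tangent_frame_exists z : S2 z -> exists E, tangent_frame z E.
Proof.
move=> zS; have rz := rank_tangent_plane zS.
have := row_base_free (kermx z^T); have := eq_row_base (kermx z^T).
move: (row_base (kermx z^T)); rewrite rz => E EE fE; exists E; split=> //.
have : (E <= kermx z^T)%MS by rewrite EE.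
by move=> /sub_kermxP H; rewrite -[z]trmxK -trmx_mul H trmx0.
Qed.

Lemma gram_unit (D : 'M[R]_(2, 3)) : row_free D -> D *m D^T \in unitmx.
Proof.
move=> fD; rewrite -row_free_unit; apply/row_freeP.
have inj (v : 'rV[R]_2) : v *m (D *m D^T) = 0 -> v = 0.
  move=> v0; have : dot (v *m D) (v *m D) = 0.
    by rewrite /dot trmx_mul mulmxA -(mulmxA v) v0 mul0mx mxE.
  by move=> /dot_eq0 vD; apply: (row_free_inj fD); rewrite vD mul0mx.
apply/row_freeP; rewrite -kermx_eq0; apply/eqP/row_matrixP => i.
by rewrite row0; apply: inj; rewrite -row_mul mulmx_ker row0.
Qed.

Lemma metric_gram x z E : metric x z E =
  (\matrix_(i < 2) dx x z E i) *m (\matrix_(i < 2) dx x z E i)^T.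
Proof. by rewrite mulmx_dot; apply/matrixP => i j; rewrite !mxE !rowK. Qed.

Lemma char_poly2 (M : 'M[R]_2) (k1 k2 : R) :
  char_poly M = ('X - k1%:P) * ('X - k2%:P) <->
  \tr M = k1 + k2 /\ \det M = k1 * k2.
Proof.
have E : ('X - k1%:P) * ('X - k2%:P) = 'X^2 - (k1 + k2) *: 'X + (k1 * k2)%:P :> {poly R}.
  by rewrite -mul_polyC polyCD polyCM; ring.
have t : (char_poly M)`_1 = - \tr M by rewrite (@char_poly_trace _ 2).
have d : (char_poly M)`_0 = \det M by rewrite char_poly_det sqrrN expr1n mul1r.
rewrite E; split=> [H|[H1 H2]].
  move: t d; rewrite H !coefE/= => t d.
  by split; [apply: oppr_inj; rewrite -t|rewrite -d]; ring.
apply/polyP => -[|[|[|i]]].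
- by rewrite d H2 !coefE/=; ring.
- by rewrite t H1 !coefE/=; ring.
- have := char_poly_monic M; rewrite monicE lead_coefE size_char_poly/= => /eqP ->.
  by rewrite !coefE/=; ring.
- rewrite nth_default; last by rewrite size_char_poly.
  by rewrite !coefE/=; ring.
Qed.

Lemma ord2P (P : 'I_2 -> Prop) : P 0 -> P 1 -> forall i, P i.
Proof.
move=> P0 P1 [[|[|//]] i2].
- by rewrite (_ : Ordinal _ = 0)//; exact: val_inj.
- by rewrite (_ : Ordinal _ = 1)//; exact: val_inj.
Qed.

Lemma sum2 (W : nmodType) (F : 'I_2 -> W) : \sum_i F i = F 0 + F 1.
Proof.
by rewrite !big_ord_recl big_ord0 addr0; congr (_ + F _); exact: val_inj.
Qed.

Lemma det2 (M : 'M[R]_2) : \det M = M 0 0 * M 1 1 - M 0 1 * M 1 0.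
Proof.
rewrite (expand_det_row _ 0) sum2 /cofactor !det_mx11 !mxE/= expr0 mul1r expr1 mulN1r mulrN.
by congr (_ * M _ _ - _ * M _ _); exact: val_inj.
Qed.

Lemma trace_det_form (g h : 'M[R]_2) : g \in unitmx ->
  \tr (h *m invmx g) * \det g =
     h 0 0 * g 1 1 - h 0 1 * g 1 0 - h 1 0 * g 0 1 + h 1 1 * g 0 0 /\
  \det (h *m invmx g) * \det g = \det h.
Proof.
move=> ug; split; last first.
  by rewrite det_mulmx det_inv mulfVK// -unitfE -unitmxE.
have hM : h = h *m invmx g *m g by rewrite mulmxKV.
move: (h *m invmx g) hM => M ->.
by rewrite det2 /mxtrace sum2 !mxE !sum2; ring.
Qed.

(** A change of frame by [S] turns both forms into [S _ S^T], hence conjugates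
the shape operator by [S]. *)
Lemma principal_curvatures_frame x z n k1 k2 E : C2_at x z -> S2 z ->
  immersion x -> tangent_frame z E -> principal_curvatures x z n k1 k2 ->
  let M := second_form x z E n *m invmx (metric x z E) in
  \tr M = k1 + k2 /\ \det M = k1 * k2.
Proof.
move=> Cx zS ix tE [_ [E' [tE' /char_poly2[trM dM]]]] M.
have [S uS EE] := tangent_frame_change zS tE tE'.
have ug : metric x z E \in unitmx by rewrite metric_gram gram_unit//; exact: ix.
move: trM dM; rewrite EE metric_change// second_form_change//.
set g := metric x z E; set h := second_form x z E n.
have -> : S *m h *m S^T *m invmx (S *m g *m S^T) = S *m M *m invmx S.
  have uST : S^T \in unitmx by rewrite unitmx_tr.
  have -> : invmx (S *m g *m S^T) = invmx S^T *m invmx g *m invmx S.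
    apply: (can_inj (mulKmx (_ : S *m g *m S^T \in unitmx))).
      by rewrite !unitmx_mul uS ug.
    rewrite mulmxV ?unitmx_mul ?uS ?ug//.
    by rewrite !mulmxA mulmxK// mulmxK// mulmxV.
  by rewrite !mulmxA mulmxK.
rewrite mxtrace_mulC mulmxA mulVmx// mul1mx !det_mulmx (det_inv S) => -> <-.
by split=> //; rewrite mulrAC divff ?mul1r// -unitfE -unitmxE.
Qed.

End Frames.

(** * Symmetry of second derivatives *)

Section Schwarz.
Context {R : realType} {V : normedModType R}.
Implicit Types (f : V -> R) (U : set V) (p u v : V).

Lemma is_derive_shift_line f p u v (s : R) : differentiable f (p + s *: u) ->
  is_derive s 1 (fun s => f (p + s *: u)) ('D_u f (p + s *: u)).
Proof.
move=> df; apply/der_line.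
have : is_derive (p + s *: u) u f ('D_u f (p + s *: u)).
  by apply: derivableP; exact: diff_derivable.
move=> /der_line; congr (is_derive _ _ _ _); apply/funext => h.
by congr (f _); rewrite scalerDl [h *: 1]mulr1 addrCA.
Qed.

(** Two applications of the mean value theorem to the second difference of [f]
on a parallelogram. *)
Lemma second_difference U f p u v (h : R) : Ck 2 U f -> 0 < h ->
  (forall s t : R, 0 <= s <= h -> 0 <= t <= h -> U (p + s *: u + t *: v)) ->
  exists s t : R, [/\ 0 <= s <= h, 0 <= t <= h &
    f (p + h *: u + h *: v) - f (p + h *: u) - (f (p + h *: v) - f p) =
    'D_v ('D_u f) (p + s *: u + t *: v) * h * h].
Proof.
move=> Cf h0 inU; have [df Df] := Cf; have [dDf _] := Df u.
pose k (s : R) := f (p + h *: v + s *: u) - f (p + s *: u).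
pose dk (s : R) := 'D_u f (p + h *: v + s *: u) - 'D_u f (p + s *: u).
have h00 : 0 <= h <= h by rewrite lexx ltW.
have z00 : 0 <= (0:R) <= h by rewrite lexx ltW.
have Dk s : 0 <= s <= h -> is_derive s 1 k (dk s).
  move=> sh; apply: derB; apply: is_derive_shift_line => //; apply: df.
    by rewrite addrAC; exact: inU.
  by have := inU s 0 sh z00; rewrite scale0r addr0.
have itvE (F dF : R -> R) : (forall s, 0 <= s <= h -> is_derive s 1 F (dF s)) ->
    exists s, 0 <= s <= h /\ F h - F 0 = dF s * h.
  move=> DF; have [||s] := @MVT _ F dF 0 h h0.
  - by move=> s; rewrite in_itv/= => /andP[s0 sh]; apply: DF; rewrite !ltW.
  - apply: continuous_in_subspaceT => s; rewrite inE/= in_itv/= => sh.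
    by apply: differentiable_continuous; apply/derivable1_diffP; have [] := DF s sh.
  rewrite in_itv/= subr0 => /andP[s0 sh] E.
  by exists s; rewrite !ltW.
have [s [sh Es]] := itvE k dk Dk.
have DDk t : 0 <= t <= h -> is_derive t 1 (fun t => 'D_u f (p + s *: u + t *: v))
   ('D_v ('D_u f) (p + s *: u + t *: v)).
  by move=> th; apply: is_derive_shift_line => //; apply: dDf; exact: inU.
have [t [th Et]] := itvE _ _ DDk.
exists s, t; split => //.
move: Es; rewrite /k /dk scale0r !addr0 [p + h *: v + s *: u]addrAC.
rewrite [p + h *: v + h *: u]addrAC => ->.
by rewrite scale0r addr0 in Et; rewrite Et.
Qed.

Lemma near_two (f g : V -> R) U p (e : R) : open U -> U p ->
  {for p, continuous f} -> {for p, continuous g} -> 0 < e ->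
  exists2 d : R, 0 < d & forall q, ball p d q ->
    [/\ U q, `|f p - f q| <= e & `|g p - g q| <= e].
Proof.
move=> oU Up /cvgrPdist_le cf /cvgrPdist_le cg e0.
have nU : \forall q \near p, U q by apply: open_nbhs_nbhs.
have : \forall q \near p, [/\ U q, `|f p - f q| <= e & `|g p - g q| <= e].
  by near=> q; split; near: q; [exact: nU|exact: cf|exact: cg].
by move=> /nbhs_ballP[d /= d0 Hd]; exists d.
Unshelve. all: by end_near. Qed.

Lemma dist_common (a b c c' r : R) : `|b - c'| <= r / 2 -> `|a - c| <= r / 2 ->
  c' = c -> `|a - b| <= r.
Proof.
move=> bc ac cc; rewrite cc distrC in bc.
by rewrite (le_trans (ler_distD c _ _))// (splitr r) lerD.
Qed.

(** The second difference is symmetric in [u] and [v]; at scale [h] it is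
[h^2] times a value of either mixed derivative near [p]. *)
Lemma derive_commute U f p u v : open U -> U p -> Ck 2 U f ->
  'D_u ('D_v f) p = 'D_v ('D_u f) p.
Proof.
move=> oU Up Cf; have [df Df] := Cf.
have c1 : {for p, continuous ('D_u ('D_v f))} by have [_ D2] := Df v; exact: (D2 u p Up).
have c2 : {for p, continuous ('D_v ('D_u f))} by have [_ D2] := Df u; exact: (D2 v p Up).
apply/eqP; rewrite -subr_eq0 -normr_le0; apply/ler_addgt0Pl => e; rewrite addr0 => e0.
have e20 : 0 < e / 2 by rewrite divr_gt0.
pose F1 : V -> R := 'D_u ('D_v f); pose F2 : V -> R := 'D_v ('D_u f).
rewrite -/(F1 p) -/(F2 p).
have [d d0 Hd] := @near_two F1 F2 U p _ oU Up c1 c2 e20.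
pose h := d / (2 * (`|u| + `|v| + 1)).
have den0 : 0 < `|u| + `|v| + 1 by rewrite ltr_wpDl// addr_ge0.
have h0 : 0 < h by rewrite divr_gt0// mulr_gt0.
have inB (a b : R) : 0 <= a <= h -> 0 <= b <= h -> forall w, w = p + a *: u + b *: v -> ball p d w.
  move=> /andP[a0 ah] /andP[b0 bh] w ->; rewrite -ball_normE/= -addrA opprD addNKr normrN.
  apply: (le_lt_trans (ler_normD _ _)); rewrite !normrZ !ger0_norm//.
  apply: (@le_lt_trans _ _ (h * `|u| + h * `|v|)).
    by rewrite lerD// ler_wpM2r.
  rewrite -mulrDr /h mulrAC ltr_pdivrMr ?mulr_gt0// ltr_pM2l//.
  by rewrite mulrDr mulr1; have := normr_ge0 u; have := normr_ge0 v; lra.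
have inU (a b : R) : 0 <= a <= h -> 0 <= b <= h -> U (p + a *: u + b *: v).
  by move=> ah bh; have [] := Hd _ (inB a b ah bh _ erefl).
have [s [t [sh th E1]]] := second_difference Cf h0 inU.
have inU' (a b : R) : 0 <= a <= h -> 0 <= b <= h -> U (p + a *: v + b *: u).
  by move=> ah bh; rewrite addrAC; exact: inU.
have [s' [t' [sh' th' E2]]] := second_difference Cf h0 inU'.
have [_ _ B1] := Hd _ (inB s t sh th _ erefl).
have [_ B2 _] := Hd _ (inB t' s' th' sh' _ (addrAC _ _ _)).
have E : F2 (p + s *: u + t *: v) = F1 (p + s' *: v + t' *: u).
  have cancel_h (a b X Y : R) : X = a * h * h -> Y = b * h * h -> X = Y -> a = b.
    have hn0 : h != 0 by rewrite gt_eqF.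
    by move=> -> -> /(mulIf hn0)/(mulIf hn0).
  apply: (cancel_h _ _ _ _ E1 E2).
  by rewrite [p + h *: v + h *: u]addrAC ; ring.
exact: (dist_common B1 B2 E).
Qed.

End Schwarz.

(** * Extension along rays of maps on the sphere *)

Section RayExtension.
Context {R : realType}.
Implicit Types (x : 'rV[R]_3 -> 'rV[R]_3) (p v z : 'rV[R]_3).

(** The vector-valued form of [Ck_comp]. *)
Lemma Ck_comp_basis (V V' : normedModType R) (k m n : nat) (U : set V) (U' : set V')
    (f : V -> V') (e : 'I_m -> V') (a : 'I_m -> V -> R) (g : V' -> 'rV[R]_n.+1) :
  open U -> open U' -> (forall q, U q -> f q = \sum_i a i q *: e i) ->
  (forall i, Ck k U (a i)) -> (forall q, U q -> U' (f q)) ->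
  Ck k U' g -> Ck k U (fun q => g (f q)).
Proof.
move=> oU oU' fE Ca fU Cg; apply: Ck_rV => // i.
have Cgi := Ck_coord i oU' Cg.
have Cc := Ck_comp (e := e) oU Ca _ Cgi.
apply: (Ck_ext oU _ (Cc _)) => [q Uq /=|q Uq]; rewrite -fE//; exact: fU.
Qed.

Lemma Ck_coord_id k (U : set 'rV[R]_3) i : open U -> Ck k U (fun q : 'rV[R]_3 => q 0 i).
Proof.
move=> oU; apply: (@Ck_coord _ _ _ _ _ id) => //.
by apply: (@Ck_lin _ _ _ k U idfun) => q; exact: cvg_id.
Qed.

Lemma Ck_sqrt k : Ck k [set u : R | 0 < u] (@Num.sqrt R).
Proof.
have oP : open [set u : R | 0 < u] by exact: open_gt.
elim: k => [|k IH]; first by move=> u _; exact: sqrt_continuous.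
apply: (@Ck_primitive _ _ _ _ (fun u => (cst 2 u * Num.sqrt u)^-1)).
- exact: oP.
- apply: CkV => //; first by move=> u u0; rewrite mulf_neq0// gt_eqF// sqrtr_gt0.
  by apply: CkM => //; exact: Ck_cst.
Qed.

Definition nonzero : set 'rV[R]_3 := [set p | 0 < dot p p].

Lemma nonzeroP p : nonzero p <-> p != 0.
Proof.
split=> [p0|p0]; last exact: dot_gt0.
by apply/eqP => pE; move: p0; rewrite /nonzero/= pE dotE !mxE !mul0r !addr0 ltxx.
Qed.

Lemma S2_nonzero z : S2 z -> nonzero z.
Proof. by move=> /S2_neq0 /nonzeroP. Qed.

Lemma Ck_dot_self k (U : set 'rV[R]_3) : open U -> Ck k U (fun p => dot p p).
Proof.
move=> oU; apply: (@Ck_ext _ _ _ _ _ (fun p : 'rV[R]_3 => \sum_(i < 3) p 0 i * p 0 i)) => //.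
  by move=> p _; rewrite sum3 dotE.
by apply: Ck_sum => // i; apply: CkM => //; exact: Ck_coord_id.
Qed.

Lemma open_nonzero : open nonzero.
Proof.
apply: (@open_comp _ _ (fun p : 'rV[R]_3 => dot p p) [set u : R | 0 < u]); last exact: open_gt.
by move=> p _; apply: (@Ck_dot_self 0 setT openT).
Qed.

Definition inv_norm p := (euclid_norm p)^-1.

Lemma euclid_norm_gt0 p : nonzero p -> 0 < euclid_norm p.
Proof. by move=> p0; rewrite sqrtr_gt0. Qed.

Lemma Ck_inv_norm k : Ck k nonzero inv_norm.
Proof.
apply: CkV; first exact: open_nonzero.
  by move=> p p0; rewrite gt_eqF// euclid_norm_gt0.
exact: (Ck_comp1 open_nonzero (Ck_dot_self k open_nonzero) _ (Ck_sqrt k)).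
Qed.

Lemma radialE p i : radial p 0 i = inv_norm p * p 0 i.
Proof. by rewrite mxE. Qed.

Lemma Ck_radial_coord k i : Ck k nonzero (fun p => radial p 0 i).
Proof.
apply: (@Ck_ext _ _ _ _ _ (fun p => inv_norm p * p 0 i)) => //.
- exact: open_nonzero.
- by move=> p _; rewrite radialE.
by apply: CkM; [exact: open_nonzero|exact: Ck_inv_norm|exact/Ck_coord_id/open_nonzero].
Qed.

Lemma Ck_radial k : Ck k nonzero (@radial R).
Proof. by apply: Ck_rV => [|i]; [exact: open_nonzero|exact: Ck_radial_coord]. Qed.

Lemma radial_continuous p : nonzero p -> {for p, continuous (@radial R)}.
Proof. exact: (Ck_radial 0). Qed.

Lemma open_ray (U : set 'rV[R]_3) : open U -> open (nonzero `&` @radial R @^-1` U).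
Proof.
move=> oU; rewrite openE => p [p0 Up]; apply: filterI.
  by apply: open_nbhs_nbhs; split => //; exact: open_nonzero.
by apply: (radial_continuous p0); apply: open_nbhs_nbhs.
Qed.

Lemma Ck_ray_ext k (U : set 'rV[R]_3) x : open U -> Ck k U x ->
  Ck k (nonzero `&` @radial R @^-1` U) (ray_ext x).
Proof.
move=> oU Cx; have oW := open_ray oU.
apply: (@Ck_comp_basis _ _ _ 3 _ _ U (@radial R) (fun i => delta_mx 0 i)
  (fun i p => radial p 0 i) x) => //.
- by move=> q _; exact: rV_comb.
- by move=> i; apply: (@Ck_sub _ _ _ _ nonzero); [move=> q []|exact: Ck_radial_coord].
- by move=> q [].
Qed.

Lemma smooth_ray_ext x z : smooth_on S2 x -> S2 z ->
  exists U : set 'rV[R]_3, [/\ open U, U z & forall k, Ck k U (ray_ext x)].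
Proof.
move=> sx zS; have [U [g [oU Uz Cg xg]]] := sx z zS.
exists (nonzero `&` @radial R @^-1` U); split.
- exact: open_ray.
- by split; [exact: S2_nonzero|rewrite /preimage/= radial_id].
- move=> k; apply: (Ck_ext (open_ray oU) _ (Ck_ray_ext oU (Cg k))) => p [p0 Up].
  by rewrite /ray_ext xg//; apply: radial_S2; exact/nonzeroP.
Qed.

Lemma smooth_C2_at x z : smooth_on S2 x -> S2 z -> C2_at x z.
Proof. by move=> sx zS; have [U [oU Uz Cx]] := smooth_ray_ext sx zS; exists U. Qed.

(** The map [G] is also defined for small negative times: it comes from the
extension that is part of smoothness up to the boundary [t = 0], and it can be
differentiated in time at [t = 0]. *)
Lemma smooth_motion_ext (T : R) (X : 'rV[R]_3 -> R -> 'rV[R]_3) z : 0 < T ->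
  smooth_on (S2 `*` `[0, T[) (fun p : 'rV[R]_3 * R => X p.1 p.2) -> S2 z ->
  exists (W : set ('rV[R]_3 * R)) (G : 'rV[R]_3 * R -> 'rV[R]_3),
    [/\ open W, W (z, 0), forall k, Ck k W G &
      forall p t, W (p, t) -> 0 <= t -> t < T -> G (p, t) = ray_ext (X^~ t) p].
Proof.
move=> T0 sX zS.
have [|U [g [oU Uz Cg Xg]]] := sX (z, 0).
  by split => //=; rewrite in_itv/= lexx T0.
pose NT : set ('rV[R]_3 * R) := [set q | nonzero q.1].
have cfst (q : 'rV[R]_3 * R) : {for q, continuous fst} by exact: cvg_fst.
have csnd (q : 'rV[R]_3 * R) : {for q, continuous snd} by exact: cvg_snd.
have oNT : open NT.
  by apply: (@open_comp _ _ fst nonzero); [move=> q _; exact: cfst|exact: open_nonzero].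
pose f (q : 'rV[R]_3 * R) := (radial q.1, q.2).
pose W := NT `&` f @^-1` U.
have oW : open W.
  rewrite openE => q [q0 Uq]; apply: filterI; first exact: open_nbhs_nbhs.
  have cf : {for q, continuous f}.
    suff cr : {for q, continuous (fun q : 'rV[R]_3 * R => radial q.1)}.
      exact: (cvg_pair cr (csnd q)).
    by apply: (@continuous_comp _ _ _ fst (@radial R)); [exact: cfst|exact: radial_continuous].
  by apply: cf; exact: open_nbhs_nbhs.
exists W, (fun q => g (f q)); split => //.
- split; first exact: S2_nonzero.
  by rewrite /preimage/f/= radial_id.
- move=> k.
  pose e (i : 'I_4) : 'rV[R]_3 * R :=
    nth (0, 1) [:: (delta_mx 0 o0, 0); (delta_mx 0 o1, 0); (delta_mx 0 o2, 0)] i.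
  pose a (i : 'I_4) (q : 'rV[R]_3 * R) : R :=
    nth q.2 [:: radial q.1 0 o0; radial q.1 0 o1; radial q.1 0 o2] i.
  apply: (@Ck_comp_basis _ _ _ 4 _ W U f e a g) => //.
  + move=> q _; rewrite /f !big_ord_recl big_ord0 /e/a/=.
    rewrite addr0; congr (_, _) => /=.
      by rewrite scaler0 addr0 addrA [LHS]rV_comb sum3.
    by rewrite !scaler0 !add0r [RHS]mulr1.
  + have Crad j : Ck k W (fun q : 'rV[R]_3 * R => radial q.1 0 j).
      apply: (@Ck_sub _ _ _ _ NT); first by move=> q [].
      apply: (@Ck_coord _ _ _ _ _ (fun q => radial q.1)) => //.
      apply: (@Ck_comp_basis _ _ _ 3 _ _ nonzero fst (fun i => delta_mx 0 i)
        (fun i q => q.1 0 i) (@radial R)) => //.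
      * exact: open_nonzero.
      * by move=> q _; exact: rV_comb.
      * move=> i; apply: (@Ck_coord _ _ _ _ _ fst) => //.
        by apply: (@Ck_lin _ _ _ k NT fst) => q; exact: cfst.
      * exact: Ck_radial.
    move=> [[|[|[|[|//]]]] i4] /=; try exact: Crad.
    by apply: (@Ck_lin _ _ _ k W snd) => q; exact: csnd.
  + by move=> q [].
- move=> p t [p0 Up] t0 tT; rewrite /f/= -(Xg (radial p, t))//.
  by split => /=; [apply: radial_S2; exact/nonzeroP|rewrite in_itv/= t0].
Qed.

End RayExtension.

(** * The pinching gap *)

Section PinchingFromFrame.
Context {R : realType}.
Implicit Types (x : 'rV[R]_3 -> 'rV[R]_3) (z n : 'rV[R]_3) (E : 'M[R]_(2, 3)).

(** If [g] is the metric and [b] the second derivatives paired with the cross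
product [N] of the frame vectors, then [N] is plus or minus
[Num.sqrt (\det g)] times the unit normal, and [pinch_gap] equals
[(\det g)^3 * (H^2 - (r + 2 + r^-1) * K)].  It is a polynomial in [g] and [b]
in which neither the choice of the normal nor its length appears. *)
Definition pinch_gap (r g00 g01 g10 g11 b00 b01 b10 b11 : R) : R :=
  (b00 * g11 - b01 * g10 - b10 * g01 + b11 * g00) ^+ 2 -
  (r + 2 + r^-1) * ((g00 * g11 - g01 * g10) * (b00 * b11 - b01 * b10)).

(** Up to a positive factor the gap is [(k2 - r k1) (k2 - k1 / r)], and the second
factor is positive since [k1 <= k2] and [1 < r]. *)
Lemma pinch_gap_ratio (k1 k2 r l g00 g01 g10 g11 b00 b01 b10 b11 h00 h01 h10 h11 : R) :
  k1 <= k2 -> 0 < k1 -> 1 < r -> g00 * g11 - g01 * g10 != 0 ->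
  l * l = g00 * g11 - g01 * g10 ->
  (k1 + k2) * (g00 * g11 - g01 * g10) =
    h00 * g11 - h01 * g10 - h10 * g01 + h11 * g00 ->
  k1 * k2 * (g00 * g11 - g01 * g10) = h00 * h11 - h01 * h10 ->
  b00 = - (l * h00) -> b01 = - (l * h01) -> b10 = - (l * h10) -> b11 = - (l * h11) ->
  0 < pinch_gap r g00 g01 g10 g11 b00 b01 b10 b11 -> r < k2 / k1.
Proof.
move=> k12 k10 r1 Dg0 l2 T1 T2 -> -> -> ->; rewrite /pinch_gap.
rewrite (_ : (_ + _) ^+ 2 = l ^+ 2 * ((k1 + k2) * (g00 * g11 - g01 * g10)) ^+ 2); last first.
  by rewrite T1; ring.
rewrite (_ : (r + 2 + r^-1) * _ = (r + 2 + r^-1) * l ^+ 2 * ((g00 * g11 - g01 * g10) *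
   (k1 * k2 * (g00 * g11 - g01 * g10)))); last first.
  by rewrite T2; ring.
rewrite -l2 => H.
have l0 : 0 < l * l by rewrite lt_neqAle l2 eq_sym Dg0 -l2 -expr2 sqr_ge0.
have {}H : 0 < (l * l) ^+ 3 * ((k1 + k2) ^+ 2 - (r + 2 + r^-1) * (k1 * k2)).
  by apply: lt_le_trans H _; rewrite le_eqVlt; apply/orP; left; apply/eqP; ring.
rewrite pmulr_rgt0 ?exprn_gt0// in H.
rewrite ltr_pdivlMr//.
have r0 : 0 < r by apply: lt_trans r1.
have {}H : 0 < (k2 - r * k1) * (k2 - r^-1 * k1).
  apply: lt_le_trans H _; rewrite le_eqVlt; apply/orP; left; apply/eqP; field.
  by rewrite gt_eqF.
have ri : r^-1 < 1 by rewrite invf_lt1.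
have : 0 < k2 - r^-1 * k1.
  by rewrite subr_gt0; apply: lt_le_trans k12; rewrite -[X in _ < X]mul1r ltr_pM2r.
by move=> p2; move: H; rewrite pmulr_lgt0// subr_gt0.
Qed.

Lemma pinching_from_frame x z n E (k1 k2 r : R) : C2_at x z -> S2 z ->
  immersion x -> tangent_frame z E -> dot n n = 1 ->
  (forall E i, tangent_frame z E -> dot (dx x z E i) n = 0) ->
  principal_curvatures x z n k1 k2 -> 0 < k1 -> 1 < r ->
  let a i := dx x z E i in let N := cross (a 0) (a 1) in
  let g i j := dot (a i) (a j) in let b i j := dot (ddx x z E i j) N in
  0 < pinch_gap r (g 0 0) (g 0 1) (g 1 0) (g 1 1) (b 0 0) (b 0 1) (b 1 0) (b 1 1) ->
  r < k2 / k1.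
Proof.
move=> Cx zS ix tE nn tn pc k10 r1 a N g b.
have k12 : k1 <= k2 by case: pc.
have [trM dM] := principal_curvatures_frame Cx zS ix tE pc.
have ug : metric x z E \in unitmx by rewrite metric_gram gram_unit//; exact: ix.
have [T1 T2] := trace_det_form (second_form x z E n) ug.
rewrite trM in T1; rewrite dM in T2; move: T1 T2; rewrite !det2 !mxE.
rewrite -/(a 0) -/(a 1).
have an i : dot (a i) n = 0 by exact: tn.
pose l := dot N n; have NE : N = l *: n by apply: cross_normal.
have l2 : l * l = g 0 0 * g 1 1 - g 0 1 * g 1 0.
  by rewrite -cross_gram -/N NE dotZl dotZr nn mulr1.
move=> T1 T2; apply: (pinch_gap_ratio k12 k10 r1 _ l2 T1 T2).
- by have := ug; rewrite unitmxE det2 !mxE unitfE.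
all: by rewrite /b NE dotZr mulrN opprK.
Qed.

End PinchingFromFrame.

(** * Directional derivatives of vector functions *)

Section VectorDerivatives.
Context {R : realType} {V : normedModType R}.
Implicit Types (f g : V -> 'rV[R]_3) (p v : V).

Lemma vderP f p v d : is_derive p v f d <->
  forall i, is_derive p v (fun q => f q 0 i) (d 0 i).
Proof.
split=> [[df <-] i|df].
  by apply: DeriveDef; [exact: (iffLR (derivable_mxP _ _ _) df)|rewrite derive_mx// mxE].
have dd : derivable f p v.
  by apply/derivable_mxP => i j; rewrite ord1; have [] := df j.
apply: (DeriveDef dd); apply/rowP => i; rewrite derive_mx// mxE.
by have [] := df i.
Qed.

Lemma vder_vec3 (a b c : V -> R) p v da db dc :
  is_derive p v a da -> is_derive p v b db -> is_derive p v c dc ->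
  is_derive p v (fun q => vec3 (a q) (b q) (c q)) (vec3 da db dc).
Proof.
move=> Da Db Dc; apply/vderP.
have F (h k l : V -> R) i : (fun q => vec3 (h q) (k q) (l q) 0 i) =
    [:: h; k; l]`_i by apply/funext => q; rewrite mxE; move: i; exact: forall_I3.
by move=> i; rewrite F mxE; move: i; exact: forall_I3.
Qed.

Lemma vderC p v (c : 'rV[R]_3) : is_derive p v (fun=> c) (0 : 'rV[R]_3).
Proof. exact: is_derive_cst. Qed.

Lemma vderD f g p v a b : is_derive p v f a -> is_derive p v g b ->
  is_derive p v (fun q => f q + g q) (a + b).
Proof. by move=> fa gb; exact: is_deriveD. Qed.

Lemma vderB f g p v a b : is_derive p v f a -> is_derive p v g b ->
  is_derive p v (fun q => f q - g q) (a - b).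
Proof. by move=> fa gb; exact: is_deriveB. Qed.

Lemma vderZ (h : V -> R) f p v dh a : is_derive p v h dh -> is_derive p v f a ->
  is_derive p v (fun q => h q *: f q) (dh *: f p + h p *: a).
Proof.
move=> Dh /vderP Df; apply/vderP => i; rewrite !mxE.
have -> : (fun q => (h q *: f q) 0 i) = (fun q => h q * f q 0 i).
  by apply/funext => q; rewrite mxE.
exact: derM.
Qed.

Lemma der_coord f p v a i : is_derive p v f a -> is_derive p v (fun q => f q 0 i) (a 0 i).
Proof. by move=> /vderP; exact. Qed.

Lemma derdot f g p v a b : is_derive p v f a -> is_derive p v g b ->
  is_derive p v (fun q => dot (f q) (g q)) (dot a (g p) + dot (f p) b).
Proof.
move=> Df Dg; have -> : (fun q => dot (f q) (g q)) = fun q =>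
   f q 0 o0 * g q 0 o0 + f q 0 o1 * g q 0 o1 + f q 0 o2 * g q 0 o2.
  by apply/funext => q; rewrite dotE.
have M i := derM (der_coord i Df) (der_coord i Dg).
apply: (is_derive_eq (derD (derD (M o0) (M o1)) (M o2))).
by rewrite !dotE; ring.
Qed.

Lemma dercross f g p v a b : is_derive p v f a -> is_derive p v g b ->
  is_derive p v (fun q => cross (f q) (g q)) (cross a (g p) + cross (f p) b).
Proof.
move=> Df Dg.
have M i j := derM (der_coord i Df) (der_coord j Dg).
have D := vder_vec3 (derB (M o1 o2) (M o2 o1)) (derB (M o2 o0) (M o0 o2)) (derB (M o0 o1) (M o1 o0)).
apply: (is_derive_eq D); apply: rV3_eq; rewrite !mxE/= ?mxE/=; ring.
Qed.

End VectorDerivatives.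

Lemma der_chain {R : realType} (V V' W : normedModType R) (f : V -> V') (g : V' -> W) p v d e :
  differentiable f p -> differentiable g (f p) ->
  is_derive p v f d -> is_derive (f p) d g e -> is_derive p v (g \o f) e.
Proof.
move=> df dg [_ fd] [_ gd].
have dgf : differentiable (g \o f) p by exact: differentiable_comp.
apply: (DeriveDef (diff_derivable dgf)).
by rewrite (deriveE v dgf) (diff_comp df dg)/= -(deriveE v df) fd -(deriveE d dg).
Qed.

(** * The derivative of the radial projection *)

Section RadialDerivative.
Context {R : realType}.
Implicit Types (p v z : 'rV[R]_3).

Lemma der_id3 p v : is_derive p v (fun q : 'rV[R]_3 => q) v.
Proof. exact: is_derive_id. Qed.

Lemma der_inv_norm p v : nonzero p ->
  is_derive p v (@inv_norm R) (- (inv_norm p ^+ 3 * dot p v)).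
Proof.
move=> p0; have n0 := euclid_norm_gt0 p0.
have D1 := @der_comp1 R _ Num.sqrt (fun q => dot q q) p v _ _ (is_derive1_sqrt p0)
  (derdot (der_id3 p v) (der_id3 p v)).
have D := @derV R _ (@euclid_norm R) p v _ (lt0r_neq0 n0) D1.
apply: (is_derive_eq D); rewrite -/(euclid_norm p) (dotC v) /inv_norm.
by field; rewrite gt_eqF.
Qed.

(** The differential of the radial projection at [p] in the direction [v]. *)
Definition tang p v := inv_norm p *: (v - dot (radial p) v *: radial p).

Lemma der_radial p v : nonzero p -> is_derive p v (@radial R) (tang p v).
Proof.
move=> p0; have D := vderZ (der_inv_norm v p0) (der_id3 p v).
apply: (is_derive_eq D); rewrite /tang /radial -/(inv_norm p) dotZl.
by apply: rV3_eq; rewrite !mxE; ring.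
Qed.

Lemma tang_normal p v : nonzero p -> dot (tang p v) (radial p) = 0.
Proof.
move=> p0; have /radial_S2 : p != 0 by exact/nonzeroP.
rewrite /S2/= => r1; rewrite /tang dotZl dotDl dotNl dotZl r1 dotC.
by rewrite mulr1 subrr mulr0.
Qed.

Lemma inv_norm_S2 z : S2 z -> inv_norm z = 1.
Proof. by move=> zS; rewrite /inv_norm /euclid_norm zS sqrtr1 invr1. Qed.

Lemma tang_S2 z v : S2 z -> tang z v = v - dot z v *: z.
Proof. by move=> zS; rewrite /tang inv_norm_S2// radial_id// scale1r. Qed.

Lemma tang_id z v : S2 z -> dot v z = 0 -> tang z v = v.
Proof. by move=> zS vz; rewrite tang_S2// dotC vz scale0r subr0. Qed.

Lemma S2_coord z : S2 z -> -1 <= z 0 o2 <= 1.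
Proof.
rewrite /S2/= dotE => zS; have := sqr_ge0 (z 0 o0); have := sqr_ge0 (z 0 o1).
rewrite !expr2 => h1 h0; apply/andP; split; nra.
Qed.

Lemma frame_row z (E : 'M[R]_(2, 3)) i : tangent_frame z E -> dot (row i E) z = 0.
Proof.
move=> [zE _]; have : (z *m E^T) 0 i = 0 by rewrite zE mxE.
by rewrite mulmx_dot mxE dotC => <-; congr dot; apply/rowP => j; rewrite mxE.
Qed.

Lemma tangent_decomp z (E : 'M[R]_(2, 3)) v : S2 z -> tangent_frame z E ->
  dot v z = 0 -> exists b : 'rV[R]_2, v = b *m E.
Proof.
move=> zS tE vz.
have vK : (v <= kermx z^T)%MS.
  by apply/sub_kermxP/matrixP => i j; rewrite !ord1 !mxE -[RHS]vz /dot mxE.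
by have /submxP[b vE] := submx_trans vK (tangent_plane_sub zS tE); exists b.
Qed.

End RadialDerivative.

(** * Surfaces of revolution parametrized by their Gauss map *)

Section Revolution.
Context {R : realType}.
Implicit Types (p v z n : 'rV[R]_3) (E : 'M[R]_(2, 3)).

(** An open interval that contains all heights of points of the sphere. *)
Definition profile_dom : set R := `]-2, 2[%classic.

(** The derivatives of [w] and [Z] make [z] the normal of the surface at the image
of [z].  The last two fields say that the radii of curvature [w] and
[rho = w - (1 - u^2) c] satisfy [rho <= w <= r * rho]. *)
Record revolution_profile (r : R) (w c Z : R -> R) : Prop := RevolutionProfile {
  prof_w_smooth : forall k, Ck k profile_dom w;
  prof_c_smooth : forall k, Ck k profile_dom c;
  prof_Z_smooth : forall k, Ck k profile_dom Z;
  prof_w_gt0 : forall u, profile_dom u -> 0 < w u;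
  prof_dw : forall u, profile_dom u -> is_derive u 1 w (u * c u);
  prof_dZ : forall u, profile_dom u -> is_derive u 1 Z (w u - (1 - u ^+ 2) * c u);
  prof_ge0 : forall u, -1 <= u <= 1 -> 0 <= (1 - u ^+ 2) * c u;
  prof_le : forall u, -1 <= u <= 1 -> (1 - u ^+ 2) * c u <= (1 - r^-1) * w u }.

Definition revolution (w Z : R -> R) p : 'rV[R]_3 :=
  vec3 (w (p 0 o2) * p 0 o0) (w (p 0 o2) * p 0 o1) (Z (p 0 o2)).

Variables (r : R) (w c Z : R -> R).
Hypothesis r1 : 1 < r.
Hypothesis prof : revolution_profile r w c Z.

Let x0 := revolution w Z.
Let rho u := w u - (1 - u ^+ 2) * c u.
Let e3 : 'rV[R]_3 := vec3 0 0 1.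

Lemma open_profile_dom : open profile_dom.
Proof. exact: itv_open. Qed.

Lemma dom_itv u : -1 <= u <= 1 -> profile_dom u.
Proof. by move=> /andP[u1 u2]; rewrite /profile_dom/= in_itv/=; apply/andP; split; lra. Qed.

Lemma dom_S2 z : S2 z -> profile_dom (z 0 o2).
Proof. by move=> /S2_coord /dom_itv. Qed.

Lemma w_gt0 u : -1 <= u <= 1 -> 0 < w u.
Proof. by move=> /dom_itv; exact: (prof_w_gt0 prof). Qed.

Lemma rho_gt0 u : -1 <= u <= 1 -> 0 < rho u.
Proof.
move=> u1; have w0 := w_gt0 u1; have := prof_le prof u1; rewrite /rho => H.
have : r^-1 * w u <= w u - (1 - u ^+ 2) * c u by lra.
by apply: lt_le_trans; rewrite mulr_gt0// invr_gt0 (lt_trans ltr01).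
Qed.

Lemma rho_le u : -1 <= u <= 1 -> rho u <= w u.
Proof. by move=> u1; have := prof_ge0 prof u1; rewrite /rho; lra. Qed.

Lemma rho_ge u : -1 <= u <= 1 -> w u <= r * rho u.
Proof.
move=> u1; have := prof_le prof u1; rewrite /rho => H.
have r0 : 0 < r by rewrite (lt_trans ltr01).
rewrite -ler_pdivrMl//; lra.
Qed.

Let surf_dom : set 'rV[R]_3 := [set p | profile_dom (p 0 o2)].

Lemma open_surf_dom : open surf_dom.
Proof.
apply: (@open_comp _ _ (fun p : 'rV[R]_3 => p 0 o2) profile_dom).
  by move=> p _; exact: coord_continuous.
exact: open_profile_dom.
Qed.

Lemma Ck_revolution k : Ck k surf_dom x0.
Proof.
have oS := open_surf_dom.
have C2 := Ck_coord_id k o2 oS.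
have Cw : Ck k surf_dom (fun p => w (p 0 o2)).
  by apply: (Ck_comp1 oS C2 _ (prof_w_smooth prof k)).
apply: Ck_rV => // i.
apply: (@Ck_ext _ _ _ _ _ (fun p => [:: w (p 0 o2) * p 0 o0; w (p 0 o2) * p 0 o1; Z (p 0 o2)]`_i)) => //.
  by move=> p _; rewrite mxE.
move: i; apply: forall_I3 => /=.
- by apply: CkM => //; exact: Ck_coord_id.
- by apply: CkM => //; exact: Ck_coord_id.
- by apply: (Ck_comp1 oS C2 _ (prof_Z_smooth prof k)).
Qed.

Lemma smooth_revolution : smooth_on S2 x0.
Proof.
move=> p pS; exists surf_dom, x0; split => //; first exact: open_surf_dom.
- exact: dom_S2.
- by move=> k; exact: Ck_revolution.
Qed.

(** The differential of the surface at a point [q] of the sphere, in a tangent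
direction [v]: [w] times the identity, corrected along the meridian direction
[e3 - q3 q]. *)
Definition dsurf (q v : 'rV[R]_3) : 'rV[R]_3 :=
  w (q 0 o2) *: v - (c (q 0 o2) * v 0 o2) *: (e3 - q 0 o2 *: q).

Lemma der_revolution q v : surf_dom q -> is_derive q v x0 (dsurf q v).
Proof.
move=> qD; have Dq i := der_coord i (der_id3 q v).
have Dw := @der_comp1 R _ w (fun q : 'rV[R]_3 => q 0 o2) q v _ _ (prof_dw prof qD) (Dq o2).
have DZ := @der_comp1 R _ Z (fun q : 'rV[R]_3 => q 0 o2) q v _ _ (prof_dZ prof qD) (Dq o2).
apply: (is_derive_eq (vder_vec3 (derM Dw (Dq o0)) (derM Dw (Dq o1)) DZ)).
by apply: rV3_eq; rewrite /dsurf /e3 !mxE/= ?mxE/=; ring.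
Qed.

Lemma differentiable_revolution q : surf_dom q -> differentiable x0 q.
Proof. by move=> qD; apply: (Ck_differentiable qD (Ck_revolution 1)). Qed.

Lemma surf_dom_radial p : nonzero p -> surf_dom (radial p).
Proof. by move=> p0; apply: dom_S2; apply: radial_S2; exact/nonzeroP. Qed.

Lemma der_ray_revolution p v : nonzero p ->
  is_derive p v (ray_ext x0) (dsurf (radial p) (tang p v)).
Proof.
move=> p0; have D0 := surf_dom_radial p0.
apply: (@der_chain R _ _ _ (@radial R) x0 p v (tang p v)).
- by apply: (Ck_differentiable p0 (Ck_radial 1)).
- exact: differentiable_revolution.
- exact: der_radial.
- exact: der_revolution.
Qed.

Lemma dx_revolution z E i : S2 z -> tangent_frame z E ->
  dx x0 z E i = dsurf z (row i E).
Proof.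
move=> zS tE; rewrite dxE; have [_ ->] := der_ray_revolution (row i E) (S2_nonzero zS).
by rewrite radial_id// tang_id//; exact: frame_row tE.
Qed.

Lemma dsurf_normal q v : S2 q -> dot v q = 0 -> dot (dsurf q v) q = 0.
Proof.
rewrite /S2/= => qS vq; rewrite /dsurf dotDl dotNl !dotZl vq dotDl dotNl dotZl qS.
by rewrite (_ : dot e3 q = q 0 o2) ?dotE /e3 ?vec3E; ring.
Qed.

Let C2_revolution z : S2 z -> C2_at x0 z.
Proof. by move=> zS; apply: smooth_C2_at => //; exact: smooth_revolution. Qed.

(** Since [z] is normal to the surface at [x0 z], differentiating
[dot ('D_v x0) z = 0] expresses the second derivatives by first ones. *)
Lemma second_derivative_normal z u v : S2 z -> 
  dot ('D_u ('D_v (ray_ext x0)) z) z = - dot (dsurf z (tang z v)) (tang z u).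
Proof.
move=> zS; have z0 := S2_nonzero zS.
have [U [oU Uz [_ DX]]] := C2_revolution zS; have [dDX _] := DX v.
have D1 : is_derive z u ('D_v (ray_ext x0)) ('D_u ('D_v (ray_ext x0)) z).
  by apply: derivableP; apply: diff_derivable; exact: dDX.
have D := derdot D1 (der_radial u z0).
have D0 : is_derive z u (fun q => dot ('D_v (ray_ext x0) q) (radial q)) (0 : R).
  apply: near_eq_is_derive (derC z u 0).
  have nz : \forall q \near z, nonzero q.
    by apply: open_nbhs_nbhs; split => //; exact: open_nonzero.
  near=> q; have q0 : nonzero q by near: q.
  have [_ ->] := der_ray_revolution v q0.
  by rewrite dsurf_normal//; [apply: radial_S2; exact/nonzeroP|exact: tang_normal].
have [_ E1] := D; have [_ E2] := D0; rewrite E2 in E1; move: E1.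
rewrite radial_id//; have [_ ->] := der_ray_revolution v z0.
by rewrite radial_id// => /eqP; rewrite eq_sym addr_eq0 => /eqP.
Unshelve. all: by end_near. Qed.

Lemma second_form_revolution z E i j : S2 z -> tangent_frame z E ->
  second_form x0 z E z i j = dot (dsurf z (row j E)) (row i E).
Proof.
move=> zS tE; rewrite mxE ddxE second_derivative_normal// opprK.
by rewrite !tang_id//; exact: frame_row tE.
Qed.

(** [A] is the matrix of the differential of [x0] in the frame [E], that is, of
the inverse of the shape operator, because [x0] is parametrized by its normal.
Its eigenvalues are the radii of curvature [w] and [rho]. *)
Lemma shape_matrix z E : S2 z -> tangent_frame z E ->
  exists A : 'M[R]_2, [/\ \tr A = w (z 0 o2) + rho (z 0 o2),
    \det A = w (z 0 o2) * rho (z 0 o2),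
    \matrix_(i < 2) dx x0 z E i = A *m E,
    second_form x0 z E z = A *m (E *m E^T) &
    metric x0 z E = A *m second_form x0 z E z].
Proof.
move=> zS tE; set u := z 0 o2.
(* In the frame the rank one part of the differential is [t *m b]: [b] holds the
   coordinates of the meridian direction and [t] the heights of the frame. *)
have e3z : dot (e3 - u *: z) z = 0.
  move: (zS); rewrite /S2/= dotDl dotNl dotZl => ->.
  by rewrite dotE /e3 !vec3E -/u; ring.
have [b bE] := tangent_decomp zS tE e3z.
pose G := E *m E^T.
pose t : 'cV[R]_2 := G *m b^T.
have tE3 i : row i E 0 o2 = t i 0.
  have : dot (row i E) (e3 - u *: z) = t i 0.
    rewrite bE /t /G -mulmxA -trmx_mul; rewrite /dot.
    by rewrite -row_mul mxE.
  move=> <-; rewrite dotDr dotNr dotZr (frame_row i tE) mulr0 subr0.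
  by rewrite dotE /e3 !vec3E; ring.
pose A : 'M[R]_2 := (w u)%:M - c u *: (t *m b).
have bt : b *m t = (1 - u ^+ 2)%:M.
  rewrite /t /G mulmxA mulmxA -mulmxA -trmx_mul -bE.
  apply/matrixP => i j; rewrite !ord1 !mxE eqxx mulr1n.
  transitivity (dot (e3 - u *: z) (e3 - u *: z)).
    by rewrite /dot mxE.
  rewrite dotDr dotNr dotZr e3z mulr0 subr0.
  by rewrite dotE !mxE/= -/u; ring.
have dxA : \matrix_(i < 2) dx x0 z E i = A *m E.
  apply/row_matrixP => i; rewrite rowK dx_revolution// /dsurf -/u tE3 bE.
  rewrite /A mulmxBl mul_scalar_mx -scalemxAl -mulmxA; move: (b *m E) t {tE3 A bt} => y t.
  by apply/rowP => k; rewrite !mxE big_ord1; ring.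
have AG : A *m G = G *m A^T.
  have trZ : (c u *: (t *m b))^T = c u *: (b^T *m t^T).
    by rewrite -trmx_mul; apply/matrixP => i j; rewrite !mxE.
  rewrite /A raddfB/= tr_scalar_mx trZ mulmxBl mulmxBr.
  rewrite mul_scalar_mx mul_mx_scalar -scalemxAl -scalemxAr /t trmx_mul trmxK.
  by rewrite (_ : G^T = G) ?mulmxA// /G trmx_mul trmxK.
have sf : second_form x0 z E z = A *m G.
  apply/matrixP => i j; rewrite second_form_revolution//.
  rewrite -dx_revolution//.
  have -> : dx x0 z E j = row j (A *m E) by rewrite -dxA rowK.
  rewrite AG /G -mulmxA -trmx_mul mulmx_dot mxE dotC.
  by congr dot; apply/rowP => k; rewrite !mxE.
have me : metric x0 z E = A *m (A *m G).
  by rewrite metric_gram dxA AG trmx_mul mulmxA -mulmxA /G mulmxA -!mulmxA.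
have btE : b 0 0 * t 0 0 + b 0 1 * t 1 0 = 1 - u ^+ 2.
  have : (b *m t) 0 0 = 1 - u ^+ 2 by rewrite bt mxE eqxx mulr1n.
  by rewrite mxE sum2.
exists A; split => //; last by rewrite sf.
- rewrite /mxtrace sum2 /A !mxE/= !big_ord1 /rho.
  by rewrite -btE; ring.
- rewrite det2 /A !mxE/= !big_ord1 /rho -btE; ring.
Qed.

Lemma immersion_revolution : immersion x0.
Proof.
move=> z E zS tE; have [A [_ dA -> _ _]] := shape_matrix zS tE.
have uA : A \in unitmx.
  have u1 := S2_coord zS.
  by rewrite unitmxE dA unitfE mulf_neq0 ?gt_eqF ?w_gt0 ?rho_gt0.
have [_ fE] := tE.
by rewrite /row_free mxrankMfree// -/(row_free A) row_free_unit.
Qed.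

Lemma curvature_revolution z E : S2 z -> tangent_frame z E ->
  let M := second_form x0 z E z *m invmx (metric x0 z E) in
  \tr M = (w (z 0 o2))^-1 + (rho (z 0 o2))^-1 /\
  \det M = (w (z 0 o2))^-1 * (rho (z 0 o2))^-1.
Proof.
move=> zS tE M; have [A [tA dA dxA sf me]] := shape_matrix zS tE.
have u1 := S2_coord zS; have w0 := w_gt0 u1; have rho0 := rho_gt0 u1.
have uA : A \in unitmx by rewrite unitmxE dA unitfE mulf_neq0 ?gt_eqF.
have uG : E *m E^T \in unitmx by apply: gram_unit; have [_] := tE.
have ME : M = 1%:M *m invmx A.
  rewrite /M me mul1mx; set h := second_form _ _ _ _.
  have uh : h \in unitmx by rewrite /h sf unitmx_mul uA.
  apply: (can_inj (mulmxK uA)); rewrite mulVmx//.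
  apply: (can_inj (mulmxK uh)); rewrite mul1mx -mulmxA mulmxKV//.
  by rewrite unitmx_mul uA.
have [T1 T2] := trace_det_form 1%:M uA.
rewrite -ME dA in T1 T2.
have n0 : w (z 0 o2) * rho (z 0 o2) != 0 by rewrite mulf_neq0 ?gt_eqF.
split; apply: (mulIf n0).
  rewrite T1; move: tA; rewrite /mxtrace sum2 => tA; rewrite !mxE/= mulr0n mulr1n.
  rewrite !mul0r !subr0 !mul1r addrC tA; field.
  by rewrite !gt_eqF.
rewrite T2 det1; field.
by rewrite !gt_eqF.
Qed.

(** The differential is invertible on the tangent plane of the sphere, so its
image is that plane. *)
Lemma normal_revolution z n E : S2 z -> tangent_frame z E -> dot n n = 1 ->
  (forall i, dot (dx x0 z E i) n = 0) -> n = z \/ n = - z.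
Proof.
move=> zS tE nn dn; have [A [_ dA dxA _ _]] := shape_matrix zS tE.
have u1 := S2_coord zS.
have uA : A \in unitmx.
  by rewrite unitmxE dA unitfE mulf_neq0 ?gt_eqF ?w_gt0 ?rho_gt0.
have En : E *m n^T = 0.
  apply: (can_inj (mulKmx uA)); rewrite mulmxA -dxA mulmx0.
  apply/matrixP => i j; rewrite !ord1 mulmx_dot !mxE rowK.
  by rewrite (_ : row 0 n = n) ?dn//; apply/rowP => k; rewrite mxE.
pose m := n - dot n z *: z.
have mz : dot m z = 0 by rewrite dotDl dotNl dotZl zS mulr1 subrr.
have [b mE] := tangent_decomp zS tE mz.
have mn : dot m n = 0.
  by rewrite mE /dot -mulmxA En mulmx0 mxE.
have m0 : m = 0.
  by apply: dot_eq0; rewrite {2}/m dotDr dotNr dotZr mn mz mulr0 subrr.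
have nE : n = dot n z *: z by apply/eqP; rewrite -subr_eq0 -/m m0.
have : dot n z ^+ 2 = 1.
  by move: nn; rewrite {1 2}nE dotZl dotZr zS mulr1 expr2.
move=> /eqP; rewrite sqrf_eq1 => /orP[/eqP d|/eqP d]; [left|right].
  by rewrite nE d scale1r.
by rewrite nE d scaleN1r.
Qed.

Lemma sum_prod_eq (a b k1 k2 : R) : k1 <= k2 -> a <= b -> k1 + k2 = a + b ->
  k1 * k2 = a * b -> k1 = a /\ k2 = b.
Proof.
move=> k12 ab S P; have : (k1 - a) * (k1 - b) = 0.
  rewrite (_ : _ * _ = k1 * (k1 + k2 - (a + b)) + (a * b - k1 * k2)); last by ring.
  by rewrite S P !subrr mulr0 addr0.
move=> /eqP; rewrite mulf_eq0 !subr_eq0 => /orP[] /eqP k1E; subst k1; split; lra.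
Qed.

Lemma principal_curvatures_revolution z n k1 k2 : S2 z -> n = z \/ n = - z ->
  principal_curvatures x0 z n k1 k2 ->
  (n = z /\ k1 = (w (z 0 o2))^-1 /\ k2 = (rho (z 0 o2))^-1) \/
  (k1 = - (rho (z 0 o2))^-1 /\ k2 = - (w (z 0 o2))^-1).
Proof.
move=> zS nz [k12 [E [tE /char_poly2[tM dM]]]].
have u1 := S2_coord zS; have w0 := w_gt0 u1; have rho0 := rho_gt0 u1.
have [T D] := curvature_revolution zS tE.
have le : (w (z 0 o2))^-1 <= (rho (z 0 o2))^-1 by rewrite lef_pV2 ?posrE// rho_le.
case: nz => nE; rewrite nE in tM dM.
  by left; split=> //; apply: sum_prod_eq => //; [rewrite -tM|rewrite -dM].
have sN : second_form x0 z E (- z) = - second_form x0 z E z.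
  by apply/matrixP => i j; rewrite !mxE dotNr.
right; apply: sum_prod_eq => //.
- by rewrite lerN2.
- by rewrite -tM sN mulNmx raddfN/= T; ring.
- rewrite -dM sN mulNmx -scaleN1r detZ D; ring.
Qed.

Lemma principal_curvatures_revolutionP z : S2 z ->
  principal_curvatures x0 z z (w (z 0 o2))^-1 (rho (z 0 o2))^-1.
Proof.
move=> zS; have u1 := S2_coord zS; have w0 := w_gt0 u1; have rho0 := rho_gt0 u1.
split; first by rewrite lef_pV2 ?posrE// rho_le.
have [E tE] := tangent_frame_exists zS; exists E; split => //.
by apply/char_poly2; exact: curvature_revolution.
Qed.

End Revolution.

Lemma compact_left_inverse_continuous (T U : topologicalType) (K : set T)
    (f : T -> U) (g : U -> T) :
  compact K -> hausdorff_space U -> {within K, continuous f} ->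
  (forall z, K z -> g (f z) = z) -> {within f @` K, continuous g}.
Proof.
move=> cK hU cf gf; apply/continuous_closedP => C cC.
apply: (iffRL (closed_subspaceP (f @` K) _)); exists (f @` (C `&` K)).
  apply: compact_closed => //; apply: continuous_compact.
    by apply: continuous_subspaceW cf => z [].
  by rewrite setIC; apply: compact_closedI.
rewrite eqEsubset; split=> [y [[z [Cz Kz] <-] _]|y [gC [z Kz zy]]].
  by split; [change (C (g (f z))); rewrite gf|exists z].
split; last by exists z.
by exists z => //; split => //; rewrite -(gf z Kz) zy.
Qed.

(** * Convexity and embeddedness *)

Section ClosedSurface.
Context {R : realType}.
Implicit Types (p v z n q : 'rV[R]_3) (E : 'M[R]_(2, 3)).

Lemma compact_S2 : compact (@S2 R).
Proof.
apply: bounded_closed_compact.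
  exists 1; split => // M M1 z zS; apply: le_trans (ltW M1).
  rewrite /Num.Def.normr/= mx_normrE; apply: bigmax_le => // -[i j] _ /=.
  rewrite ord1 -(@ler_pXn2r _ 2)// ?nnegrE// expr1n real_normK ?num_real//.
  have := zS; rewrite /S2/= dotE => zE.
  move: j; apply: forall_I3; have := sqr_ge0 (z 0 o0); have := sqr_ge0 (z 0 o1);
    have := sqr_ge0 (z 0 o2); nra.
rewrite (_ : S2 = (fun z => dot z z) @^-1` [set x | x = 1])//.
apply: preimage_closed; last exact: closed_eq.
by move=> z _; apply: (@Ck_dot_self R 0 setT openT).
Qed.

(** The function [u / Num.sqrt (1 - u^2)] is increasing; written without quotient
for [u], where the root may vanish. *)
Lemma slope_compare (u v a b : R) : v <= u -> 0 < a -> 0 <= b ->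
  a ^+ 2 = 1 - v ^+ 2 -> b ^+ 2 = 1 - u ^+ 2 -> v * b <= u * a.
Proof.
move=> vu a0 b0 aE bE.
have E : (u * a) ^+ 2 - (v * b) ^+ 2 = (u - v) * (u + v).
  by rewrite !exprMn aE bE; ring.
have [u0|u0] := leP 0 u.
  have [v0|v0] := leP 0 v.
    rewrite -(@ler_pXn2r _ 2)// ?nnegrE ?mulr_ge0//; last exact: ltW.
    by rewrite /= -subr_ge0 E; apply: mulr_ge0; [rewrite subr_ge0|exact: addr_ge0].
  by apply: (@le_trans _ _ 0); [rewrite mulr_le0_ge0// ltW|rewrite mulr_ge0// ltW].
have v0 : v < 0 by apply: le_lt_trans u0.
have A0 : 0 <= - u * a by rewrite mulr_ge0 ?oppr_ge0 ?ltW.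
have B0 : 0 <= - v * b by apply: mulr_ge0 => //; rewrite oppr_ge0 ltW.
have H : (- u * a) ^+ 2 <= (- v * b) ^+ 2.
  rewrite -subr_ge0 (_ : _ - _ = (u - v) * - (u + v)); last by rewrite mulrN -E; ring.
  by apply: mulr_ge0; [rewrite subr_ge0|lra].
by move: H; rewrite ler_pXn2r ?nnegrE// !mulNr lerN2.
Qed.

Variables (r : R) (w c Z : R -> R).
Hypothesis r1 : 1 < r.
Hypothesis prof : revolution_profile r w c Z.

Let x0 := revolution w Z.
Let rho u := w u - (1 - u ^+ 2) * c u.

(** The point of parameter [u] of the meridian is the highest one in the
direction [(Num.sqrt (1 - u^2), u)]: as a function of the parameter [s], the
height has as derivative a positive multiple of
[u * Num.sqrt (1 - s^2) - s * Num.sqrt (1 - u^2)], which has the sign of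
[u - s]. *)
Lemma profile_support (u v : R) : -1 <= u <= 1 -> -1 <= v <= 1 ->
  w v * Num.sqrt (1 - v ^+ 2) * Num.sqrt (1 - u ^+ 2) + Z v * u <=
  w u * Num.sqrt (1 - u ^+ 2) * Num.sqrt (1 - u ^+ 2) + Z u * u.
Proof.
move=> u1 v1; pose b := Num.sqrt (1 - u ^+ 2).
have sq (s : R) : -1 <= s <= 1 -> 0 <= 1 - s ^+ 2 by move=> /andP[? ?]; rewrite expr2; nra.
have bE : b ^+ 2 = 1 - u ^+ 2 by rewrite sqr_sqrtr// sq.
pose f (s : R) := w s * Num.sqrt (1 - s ^+ 2) * b + Z s * u.
pose df (s : R) := rho s * (u - s * b / Num.sqrt (1 - s ^+ 2)).
have cf (s : R) : -1 <= s <= 1 -> {for s, continuous f}.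
  move=> s1; have sD := dom_itv s1.
  have cw : {for s, continuous w} := Ck_continuous sD (prof_w_smooth prof 0).
  have cZ : {for s, continuous Z} := Ck_continuous sD (prof_Z_smooth prof 0).
  have cs : {for s, continuous (fun s : R => Num.sqrt (1 - s ^+ 2))}.
    apply: (@continuous_comp _ _ _ (fun s : R => 1 - s ^+ 2) Num.sqrt); last exact: sqrt_continuous.
    by apply: cvgB; [exact: cvg_cst|exact: exprn_continuous].
  apply: cvgD; last by apply: cvgM => //; exact: cvg_cst.
  by apply: cvgM; [exact: cvgM|exact: cvg_cst].
have Df (s : R) : -1 < s < 1 -> is_derive s 1 f (df s).
  move=> s1; have s1' : -1 <= s <= 1 by case/andP: s1 => *; rewrite !ltW.
  have sD := dom_itv s1'.
  have p0 : 0 < 1 - s ^+ 2 by case/andP: s1 => ? ?; rewrite expr2; nra.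
  have Dq := derB (derC s 1 (1:R)) (derX 2 (derId s)).
  have Ds := @der_comp1 R _ Num.sqrt (fun s : R => 1 - s ^+ 2) s 1 _ _ (is_derive1_sqrt p0) Dq.
  have D := derD (derM (derM (prof_dw prof sD) Ds) (derC s 1 b)) (derM (prof_dZ prof sD) (derC s 1 u)).
  apply: (is_derive_eq D); rewrite /df /rho.
  have a0 : 0 < Num.sqrt (1 - s ^+ 2) by rewrite sqrtr_gt0.
  have aE : 1 - s ^+ 2 = Num.sqrt (1 - s ^+ 2) ^+ 2 by rewrite sqr_sqrtr// ltW.
  rewrite [X in w s - X * _]aE; move: (Num.sqrt (1 - s ^+ 2)) a0 {aE Ds D} => a a0.
  by rewrite expr1; field; rewrite gt_eqF.
have key (s t : R) : s < t -> -1 <= s -> t <= 1 -> exists2 y, s < y < t & f t - f s = df y * (t - s).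
  move=> st s1 t1; have [||y] := @MVT R f df s t st.
  - move=> y; rewrite in_itv/= => /andP[sy yt]; apply: Df.
    by rewrite (le_lt_trans s1 sy) (lt_le_trans yt t1).
  - apply: continuous_in_subspaceT => y; rewrite inE/= in_itv/= => /andP[sy yt].
    by apply: cf; rewrite (le_trans s1 sy) (le_trans yt t1).
  by rewrite in_itv/= => yst E; exists y.
have sgn (y : R) : -1 < y < 1 -> rho y > 0 /\ 0 < Num.sqrt (1 - y ^+ 2) /\
    Num.sqrt (1 - y ^+ 2) ^+ 2 = 1 - y ^+ 2.
  move=> y1; have y1' : -1 <= y <= 1 by case/andP: y1 => *; rewrite !ltW.
  have p0 : 0 < 1 - y ^+ 2 by case/andP: y1 => ? ?; rewrite expr2; nra.
  by split; [exact: (rho_gt0 r1 prof)|rewrite sqrtr_gt0 sqr_sqrtr ?ltW].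
have b0 : 0 <= b by rewrite sqrtr_ge0.
case/andP: (u1) => u1a u1b; case/andP: (v1) => v1a v1b.
rewrite -/b -/(f v) -/(f u); have [vu|uv|-> //] := ltgtP v u.
  have [y /andP[vy yu] E] := key v u vu v1a u1b.
  have [|rh [a0 aE]] := sgn y; first by rewrite (le_lt_trans v1a vy) (lt_le_trans yu u1b).
  rewrite -subr_ge0 E mulr_ge0 ?subr_ge0 ?(ltW vu)// mulr_ge0 ?(ltW rh)//.
  by rewrite subr_ge0 ler_pdivrMr//; apply: slope_compare => //; exact: ltW.
have [y /andP[uy yv] E] := key u v uv u1a v1b.
have [|rh [a0 aE]] := sgn y; first by rewrite (le_lt_trans u1a uy) (lt_le_trans yv v1b).
rewrite -subr_le0 E mulr_le0_ge0 ?subr_ge0 ?(ltW uv)// mulr_ge0_le0 ?(ltW rh)//.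
rewrite subr_le0 ler_pdivlMr//.
have := @slope_compare (- u) (- y) (Num.sqrt (1 - y ^+ 2)) b.
by rewrite !sqrrN !mulNr !lerN2; apply=> //; exact: ltW.
Qed.

(** The plane through [x0 z] with normal [z] supports the surface: by the
Cauchy-Schwarz inequality in the horizontal plane this reduces to the meridian. *)
Lemma revolution_support z q : S2 z -> S2 q -> dot (x0 q) z <= dot (x0 z) z.
Proof.
move=> zS qS; have u1 := S2_coord zS; have v1 := S2_coord qS.
have := profile_support u1 v1.
have wq : 0 < w (q 0 o2) by exact: (w_gt0 prof).
move: (zS) (qS); rewrite /S2/= !dotE /x0 /revolution !vec3E => zE qE.
set u := z 0 o2 in u1 zE *; set v := q 0 o2 in v1 qE wq *.
pose a := Num.sqrt (1 - v ^+ 2); pose b := Num.sqrt (1 - u ^+ 2).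
have aE : a ^+ 2 = q 0 o0 ^+ 2 + q 0 o1 ^+ 2.
  rewrite sqr_sqrtr -?qE; first by rewrite !expr2; ring.
  rewrite (_ : _ - _ = q 0 o0 ^+ 2 + q 0 o1 ^+ 2) ?addr_ge0 ?sqr_ge0//.
  by rewrite !expr2; ring.
have bE : b ^+ 2 = z 0 o0 ^+ 2 + z 0 o1 ^+ 2.
  rewrite sqr_sqrtr -?zE; first by rewrite !expr2; ring.
  rewrite (_ : _ - _ = z 0 o0 ^+ 2 + z 0 o1 ^+ 2) ?addr_ge0 ?sqr_ge0//.
  by rewrite !expr2; ring.
rewrite -/a -/b => H.
have a0 : 0 <= a by rewrite sqrtr_ge0.
have b0 : 0 <= b by rewrite sqrtr_ge0.
have CS : q 0 o0 * z 0 o0 + q 0 o1 * z 0 o1 <= a * b.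
  apply: le_trans (ler_norm _) _; rewrite -(@ler_pXn2r _ 2)// ?nnegrE ?mulr_ge0//.
  rewrite real_normK ?num_real// exprMn aE bE -subr_ge0.
  rewrite (_ : _ - _ = (q 0 o0 * z 0 o1 - q 0 o1 * z 0 o0) ^+ 2) ?sqr_ge0//; ring.
have L : w v * (q 0 o0 * z 0 o0 + q 0 o1 * z 0 o1) <= w v * (a * b) by rewrite ler_pM2l.
have E : w u * b * b = w u * (z 0 o0 ^+ 2 + z 0 o1 ^+ 2) by rewrite -mulrA -expr2 bE.
rewrite E in H; move: H L; rewrite !expr2; lra.
Qed.

(** The open ray from [x0 z] in the direction [z] is connected, unbounded and, by
the support property, disjoint from the surface. *)
Lemma exterior_revolution z (s : R) : S2 z -> 0 < s -> exterior (x0 @` S2) (x0 z + s *: z).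
Proof.
move=> zS s0; pose ray := (fun t : R => x0 z + t *: z) @` [set t | 0 < t].
have rayM : ray `<=` ~` (x0 @` S2).
  move=> _ [t /= t0 <-] [q qS xq]; have := revolution_support zS qS.
  by rewrite xq dotDl dotZl zS mulr1; lra.
have cray : connected ray.
  apply: connected_continuous_connected.
    rewrite (_ : [set t | 0 < t] = `]0, +oo[%classic); last first.
      by apply/seteqP; split=> t /=; rewrite in_itv/= andbT.
    by apply/connected_intervalP; exact: interval_is_interval.
  apply: continuous_subspaceT => t; apply: cvgD; first exact: cvg_cst.
  by apply: cvgZr_tmp; exact: cvg_id.
have sub : ray `<=` connected_component (~` (x0 @` S2)) (x0 z + s *: z).
  by apply: connected_component_max => //; exists s.
move=> [M [_ HM]]; have z0 : 0 < `|z| by rewrite normr_gt0 S2_neq0.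
pose M' := `|M| + 1.
have MM : M < M' by rewrite (le_lt_trans (ler_norm M))// ltrDl.
have M0 : 0 < M' by rewrite ltr_wpDl.
pose t := (M' + `|x0 z| + 1) / `|z|.
have t0 : 0 < t by rewrite divr_gt0// ltr_wpDl// addr_ge0// ltW.
have := HM M' MM (x0 z + t *: z) (sub _ (ex_intro2 _ _ t t0 erefl)).
rewrite /= leNgt => /negP; apply.
have : `|t *: z| - `|x0 z| <= `|x0 z + t *: z|.
  by rewrite [x0 z + _]addrC lerB_normD.
apply: lt_le_trans; rewrite normrZ gtr0_norm// /t divfK ?gt_eqF//; lra.
Qed.

Lemma outward_revolution z : S2 z -> outward_unit_normal x0 z z.
Proof.
move=> zS; split => //.
- move=> E i tE; rewrite (dx_revolution prof)//; apply: dsurf_normal => //.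
  exact: frame_row tE.
- near=> s; apply: exterior_revolution => //.
Unshelve. all: by end_near. Qed.

Lemma strictly_convex_revolution : strictly_convex x0.
Proof.
move=> z zS; have u1 := S2_coord zS.
exists z, (w (z 0 o2))^-1, (rho (z 0 o2))^-1; split.
- exact: outward_revolution.
- exact: (principal_curvatures_revolutionP r1 prof).
- by rewrite invr_gt0 (w_gt0 prof).
- by rewrite invr_gt0 (rho_gt0 r1 prof).
Qed.

(** [Z] is strictly increasing, because its derivative is [rho]. *)
Lemma revolution_inj : set_inj S2 x0.
Proof.
move=> z q; rewrite !inE => zS qS E.
have E3 : Z (z 0 o2) = Z (q 0 o2) by have := congr1 (fun m : 'rV[R]_3 => m 0 o2) E; rewrite !vec3E.
have incr (u v : R) : -1 <= u <= 1 -> -1 <= v <= 1 -> u < v -> Z u < Z v.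
  move=> /andP[u1 u2] /andP[v1 v2] uv.
  have inD y : u <= y <= v -> -1 <= y <= 1.
    by move=> /andP[uy yv]; rewrite (le_trans u1 uy) (le_trans yv v2).
  have [||y] := @MVT R Z rho u v uv.
  - move=> y; rewrite in_itv/= => /andP[uy yv].
    by apply: (prof_dZ prof); apply: dom_itv; apply: inD; rewrite !ltW.
  - apply: continuous_in_subspaceT => y; rewrite inE/= in_itv/= => /inD /dom_itv yD.
    exact: (Ck_continuous yD (prof_Z_smooth prof 0)).
  rewrite in_itv/= => /andP[uy yv] EZ.
  have rh : 0 < rho y by apply: (rho_gt0 r1 prof); apply: inD; rewrite !ltW.
  by rewrite -subr_gt0 EZ; apply: mulr_gt0 => //; rewrite subr_gt0.
have u1 := S2_coord zS; have v1 := S2_coord qS.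
have uv : z 0 o2 = q 0 o2.
  have [uv|uv|//] := ltgtP (z 0 o2) (q 0 o2).
    by have := incr _ _ u1 v1 uv; rewrite E3 ltxx.
  by have := incr _ _ v1 u1 uv; rewrite E3 ltxx.
have w0 : w (q 0 o2) != 0 by rewrite gt_eqF// (w_gt0 prof).
apply: rV3_eq => //; apply: (mulfI w0).
  by have := congr1 (fun m : 'rV[R]_3 => m 0 o0) E; rewrite !vec3E uv.
by have := congr1 (fun m : 'rV[R]_3 => m 0 o1) E; rewrite !vec3E uv.
Qed.

Lemma smooth_embedding_revolution : smooth_embedding x0.
Proof.
split.
- exact: (smooth_revolution prof).
- exact: (immersion_revolution r1 prof).
- exact: revolution_inj.
have /choice[y yP] : forall p, exists z, (x0 @` S2) p -> S2 z /\ x0 z = p.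
  move=> p; have [[z zS zp]|np] := pselect ((x0 @` S2) p); first by exists z.
  by exists 0 => /np.
have yx z : S2 z -> y (x0 z) = z.
  move=> zS; have [|yS yE] := yP (x0 z); first by exists z.
  by apply: revolution_inj; rewrite ?inE.
exists y; split => //; apply: compact_left_inverse_continuous => //.
- exact: compact_S2.
- apply: continuous_in_subspaceT => z; rewrite inE => zS.
  by apply: (@Ck_revolution R r w c Z prof 0); exact: dom_S2.
Qed.

(** For the normal [z] the quotient of the curvatures is [w / rho <= r]; for the
normal [- z] it is [rho / w <= 1]. *)
Lemma pinching_ratio_revolution z0 : S2 z0 ->
  w (z0 0 o2) = r * rho (z0 0 o2) -> pinching_ratio x0 = r%:E.
Proof.
move=> zS0 wr; apply/eqP; rewrite eq_le; apply/andP; split.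
  apply: ge_ereal_sup => _ [z [n [k1 [k2 [zS [nn tn _] pc ->]]]]].
  have u1 := S2_coord zS; have w0 := w_gt0 prof u1; have rh := rho_gt0 r1 prof u1.
  have [E tE] := tangent_frame_exists zS.
  have nz := normal_revolution r1 prof zS tE nn (fun i => tn E i tE).
  rewrite lee_fin; have := principal_curvatures_revolution r1 prof zS nz pc.
  move=> [[_ [-> ->]]|[-> ->]].
    by rewrite invrK mulrC ler_pdivrMr// (rho_ge r1 prof).
  rewrite invrN invrK mulrNN mulrC ler_pdivrMr//.
  apply: le_trans (rho_le prof u1) _.
  by rewrite ler_peMl ?ltW.
apply: ereal_sup_ubound; exists z0, z0, (w (z0 0 o2))^-1, (rho (z0 0 o2))^-1; split => //.
- exact: outward_revolution.
- exact: (principal_curvatures_revolutionP r1 prof).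
- have rh := rho_gt0 r1 prof (S2_coord zS0).
  by rewrite invrK wr mulrCA mulVf ?mulr1// gt_eqF.
Qed.

End ClosedSurface.

(** * A profile with a plateau of the curvature ratio *)

Section ProfileExists.
Context {R : realType}.

Lemma Ck_idR k (U : set R) : Ck k U (fun u : R => u).
Proof. by apply: (@Ck_lin R R R k U idfun) => x; exact: cvg_id. Qed.

(** With a bump function equal to 1 near [u0], vanishing near -1 and 1, take
[pp = m * bump / (1 - u^2)], which is smooth on the whole line, then
[w = exp L] with [L' = u * pp], and [c = pp * w]; thus
[(1 - u^2) c = m * bump * w] for [u] between -1 and 1. *)
Lemma profile_exists (r u0 : R) : 1 < r -> 0 < u0 < 1 ->
  exists w c Z : R -> R, revolution_profile r w c Z /\
    \forall u \near u0, (1 - u ^+ 2) * c u = (1 - r^-1) * w u.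
Proof.
move=> r1 /andP[u00 u01]; pose m := 1 - r^-1.
have m0 : 0 <= m by rewrite subr_ge0 invf_le1 ?ltW// (lt_trans ltr01).
(* The bump is supported where [|u - u0| <= Num.sqrt 2 * d], away from 1 since
   [4 * d = 1 - u0] and from -1 since [u0 > 0]. *)
have [d d0 dE] : exists2 d : R, 0 < d & 4 * d = 1 - u0.
  by exists ((1 - u0) / 4); [rewrite divr_gt0// subr_gt0|field].
pose bump (u : R) := smooth_step (2 - (u - u0) / d * ((u - u0) / d)).
pose pp (u : R) := m * bump u * (1 - u * u)^-1.
have Cq k : Ck k setT (fun u : R => (u - u0) / d).
  apply: (CkM (f := fun u => u - u0) (g := cst d^-1) openT); last exact: Ck_cst.
  by apply: (CkB (g := cst u0) openT (Ck_idR _ _)); exact: Ck_cst.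
have Cbump k : Ck k setT bump.
  apply: (Ck_comp1 openT _ _ (Ck_smooth_step k)) => //.
  by apply: (CkB (f := cst 2) openT _ (CkM openT (Cq k) (Cq k))); exact: Ck_cst.
have oI : open [set u : R | -1 < u < 1].
  rewrite (_ : mkset _ = `]-1, 1[%classic); first exact: itv_open.
  by apply/seteqP; split=> u /=; rewrite in_itv.
have pos (u : R) : -1 < u < 1 -> 0 < 1 - u * u by move=> /andP[a b]; nra.
pose D2 : set R := [set u | 2 < (u - u0) / d * ((u - u0) / d)].
have oD2 : open D2.
  apply: (@open_comp _ _ (fun u : R => (u - u0) / d * ((u - u0) / d)) [set y | 2 < y]); last exact: open_gt.
  by move=> u _; exact: (Ck_continuous _ (CkM openT (Cq 0%N) (Cq 0%N))).
have pp0 u : D2 u -> pp u = 0.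
  by move=> Du; rewrite /pp /bump smooth_step0 ?mulr0 ?mul0r// subr_le0 ltW.
have cover (u : R) : -1 < u < 1 \/ D2 u.
  have [|nu] := pselect (-1 < u < 1); first by left.
  right; rewrite /D2/= (_ : _ * _ = (u - u0) * (u - u0) / (d * d)); last by field; rewrite gt_eqF.
  rewrite ltr_pdivlMr ?mulr_gt0//.
  have [u1|u1] := ltP u 1.
    have [u2|u2] := ltP (-1) u; first by case: nu; rewrite u1 u2.
    have h : 4 * d <= u0 - u by lra.
    by clear -h d0; nra.
  have h : 4 * d <= u - u0 by lra.
  by clear -h d0; nra.
have Cpp k : Ck k setT pp.
  apply: (@Ck_sub _ _ _ k ([set u : R | -1 < u < 1] `|` D2)) => [v _|]; first exact: cover.
  apply: Ck_cup; last first.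
    by apply: (Ck_ext oD2 _ (Ck_cst k D2 0)) => u Du; rewrite pp0.
  apply: (CkM (f := fun u => m * bump u) oI).
    apply: (CkM (f := cst m) oI); first exact: Ck_cst.
    by apply: Ck_sub (Cbump k).
  apply: CkV => //; first by move=> u u1; rewrite gt_eqF// pos.
  by apply: (CkB (f := cst 1) oI); [exact: Ck_cst|apply: CkM => //; exact: Ck_idR].
have CuP k : Ck k setT (fun u : R => u * pp u) by apply: CkM => //; [exact: openT|exact: Ck_idR].
have n33 : -3 < 3 :> R by lra.
have [u _|L DL] := @primitive_exists R (fun u => u * pp u) (-3) 3 n33.
  exact: (Ck_continuous _ (CuP 0%N)).
pose w u := expR (L u).
have Dw (u : R) : -3 < u < 3 -> is_derive u 1 w (u * (pp u * w u)).
  move=> u3; apply: (is_derive_eq (der_expR (DL u u3))); rewrite /w; ring.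
pose J : set R := `]-3, 3[%classic.
have oJ : open J by exact: itv_open.
have JE u : J u = (-3 < u < 3) :> Prop by rewrite /J/= in_itv.
have CL k : Ck k J L.
  apply: CkW; apply: (Ck_primitive oJ (Ck_sub (@subsetT _ _) (CuP k))).
have Cw k : Ck k J w by apply: (Ck_comp1 oJ (CL k) _ (Ck_expR k)).
pose h u := w u - (1 - u ^+ 2) * (pp u * w u).
have Cc k : Ck k J (fun u => pp u * w u).
  by apply: CkM => //; apply: Ck_sub (Cpp k).
have Cs k : Ck k J (fun u : R => 1 - u ^+ 2).
  apply: (CkB (f := cst 1) oJ); first exact: Ck_cst.
  by apply: (Ck_ext oJ _ (CkM oJ (Ck_idR k _) (Ck_idR k _))) => u _; rewrite expr2.
have Ch k : Ck k J h by exact: (CkB oJ (Cw k) (CkM oJ (Cs k) (Cc k))).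
have n22 : -2 < 2 :> R by lra.
have [u|Z DZ] := @primitive_exists R h (-2) 2 n22.
  rewrite in_itv/= => /andP[u2 u2']; apply: (Ck_continuous _ (Ch 0%N)).
  by rewrite JE; apply/andP; split; lra.
have sD : @profile_dom R `<=` J.
  by move=> u; rewrite JE /profile_dom/= in_itv/= => /andP[a b]; apply/andP; split; lra.
have w0 u : 0 < w u by exact: expR_gt0.
have ppE (u : R) : -1 < u < 1 -> (1 - u ^+ 2) * (pp u * w u) = m * bump u * w u.
  by move=> u1; rewrite /pp expr2; field; rewrite gt_eqF// pos.
have sq1 (u : R) : -1 <= u <= 1 -> -1 < u < 1 \/ 1 - u ^+ 2 = 0.
  move=> /andP[a b]; move: a b; rewrite !le_eqVlt => /orP[/eqP <- _|a].
    by right; rewrite sqrrN expr1n subrr.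
  move=> /orP[/eqP ->|b]; first by right; rewrite expr1n subrr.
  by left; rewrite a b.
exists w, (fun u => pp u * w u), Z; split.
  split.
  - by move=> k; apply: Ck_sub (Cw k).
  - by move=> k; apply: Ck_sub (Cc k).
  - move=> k; apply: CkW; apply: (Ck_primitive open_profile_dom (Ck_sub sD (Ch k))).
  - by move=> u _.
  - by move=> u /sD; rewrite JE; exact: Dw.
  - by move=> u; rewrite /profile_dom/= in_itv/=; exact: DZ.
  - move=> u /sq1[u1|->]; last by rewrite mul0r.
    rewrite ppE//; apply: mulr_ge0; last exact: ltW.
    by apply: mulr_ge0 => //; exact: smooth_step_ge0.
  - move=> u /sq1[u1|->]; last by rewrite mul0r; apply: mulr_ge0 => //; exact: ltW.
    by rewrite ppE// ler_pM2r// ler_piMr// smooth_step_le1.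
near=> u; rewrite ppE.
  rewrite /bump smooth_step1 ?mulr1// (_ : _ * _ = (u - u0) * (u - u0) / (d * d)); last by field; rewrite gt_eqF.
  have : (u - u0) * (u - u0) / (d * d) <= 1; last by lra.
  rewrite ler_pdivrMr ?mulr_gt0// mul1r.
  have : `|u0 - u| <= d by near: u; exact: cvgr_dist_le.
  by rewrite ler_norml => /andP[a b]; nra.
apply/andP; split; near: u; [apply: lt_nbhsr|exact: lt_nbhsl].
by apply: lt_trans u00; lra.
Unshelve. all: by end_near. Qed.

End ProfileExists.

(** * Second derivatives at a point of the sphere *)

Section SecondDerivatives.
Context {R : realType}.
Implicit Types (p v z : 'rV[R]_3).

Lemma der_ray_scalar (a : R -> R) da p v : nonzero p ->
  is_derive (radial p 0 o2) 1 a da ->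
  is_derive p v (fun q => a (radial q 0 o2)) (da * tang p v 0 o2).
Proof.
move=> p0 Da; apply: (@der_comp1 R _ a (fun q => radial q 0 o2)) => //.
exact: der_coord (der_radial v p0).
Qed.

Lemma der_tang z v : S2 z -> dot v z = 0 ->
  is_derive z v (fun q => tang q v) (- dot v v *: z).
Proof.
move=> zS vz; have z0 := S2_nonzero zS.
have Dr := der_radial v z0.
have D := vderZ (der_inv_norm v z0) (vderB (vderC z v v) (vderZ (derdot Dr (vderC z v v)) Dr)).
apply: (is_derive_eq D); rewrite inv_norm_S2// radial_id// tang_id// dotC vz.
rewrite (_ : dot z 0 = 0); last by rewrite dotE !mxE; ring.
by apply: rV3_eq; rewrite !mxE; ring.
Qed.

(** The extension along rays of the velocity [- phi(u) z] at the point [z] of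
height [u]. *)
Definition normal_field (phi : R -> R) p : 'rV[R]_3 := - phi (radial p 0 o2) *: radial p.

Lemma der_normal_field phi dphi p v : nonzero p ->
  is_derive (radial p 0 o2) 1 phi dphi ->
  is_derive p v (normal_field phi)
    (- (dphi * tang p v 0 o2) *: radial p + - phi (radial p 0 o2) *: tang p v).
Proof.
move=> p0 Dphi.
exact: (vderZ (derN (der_ray_scalar v p0 Dphi)) (der_radial v p0)).
Qed.

Lemma der2_normal_field (phi dphi : R -> R) ddphi z v : S2 z -> dot v z = 0 ->
  (forall u : R, -1 <= u <= 1 -> is_derive u 1 phi (dphi u)) ->
  is_derive (z 0 o2) 1 dphi ddphi ->
  is_derive z v ('D_v (normal_field phi))
    ((- ddphi * v 0 o2 ^+ 2 + dot v v * (dphi (z 0 o2) * z 0 o2 + phi (z 0 o2))) *: z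
     - (2 * dphi (z 0 o2) * v 0 o2) *: v).
Proof.
move=> zS vz Dphi Ddphi; have z0 := S2_nonzero zS.
have u1 := S2_coord zS.
have rz : radial z = z by exact: radial_id.
have Ddphi' : is_derive (radial z 0 o2) 1 dphi ddphi by rewrite rz.
have Dphi' : is_derive (radial z 0 o2) 1 phi (dphi (z 0 o2)) by rewrite rz; exact: Dphi.
have Dt := der_tang zS vz.
have D := vderD
  (vderZ (derN (derM (der_ray_scalar v z0 Ddphi') (der_coord o2 Dt))) (der_radial v z0))
  (vderZ (derN (der_ray_scalar v z0 Dphi')) Dt).
have D2 : is_derive z v (fun q => - (dphi (radial q 0 o2) * tang q v 0 o2) *: radial q +
    - phi (radial q 0 o2) *: tang q v)
  ((- ddphi * v 0 o2 ^+ 2 + dot v v * (dphi (z 0 o2) * z 0 o2 + phi (z 0 o2))) *: z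
     - (2 * dphi (z 0 o2) * v 0 o2) *: v).
  apply: (is_derive_eq D); rewrite rz tang_id//.
  by apply: rV3_eq; rewrite !mxE; ring.
apply: near_eq_is_derive D2.
have nz : \forall q \near z, nonzero q.
  by apply: open_nbhs_nbhs; split => //; exact: open_nonzero.
near=> q; have q0 : nonzero q by near: q.
have q1 : -1 <= radial q 0 o2 <= 1.
  by apply: S2_coord; apply: radial_S2; exact/nonzeroP.
by have [_ ->] := der_normal_field v q0 (Dphi _ q1).
Unshelve. all: by end_near. Qed.

Lemma der2_revolution (r : R) w c Z dc z v : revolution_profile r w c Z ->
  S2 z -> dot v z = 0 -> is_derive (z 0 o2) 1 c dc ->
  is_derive z v ('D_v (ray_ext (revolution w Z)))
    (- (dot v v * w (z 0 o2)) *: z + (2 * z 0 o2 * c (z 0 o2) * v 0 o2) *: v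
     + (c (z 0 o2) * v 0 o2 ^+ 2) *: z
     - (dc * v 0 o2 ^+ 2 - dot v v * c (z 0 o2) * z 0 o2) *: (vec3 0 0 1 - z 0 o2 *: z)).
Proof.
move=> prof zS vz Dc; have z0 := S2_nonzero zS; have u1 := S2_coord zS.
have rz : radial z = z by exact: radial_id.
have Dc' : is_derive (radial z 0 o2) 1 c dc by rewrite rz.
have Dw' : is_derive (radial z 0 o2) 1 w (z 0 o2 * c (z 0 o2)).
  by rewrite rz; apply: (prof_dw prof); exact: dom_itv.
have Dt := der_tang zS vz; have Dr := der_radial v z0.
have D := vderB (vderZ (der_ray_scalar v z0 Dw') Dt)
  (vderZ (derM (der_ray_scalar v z0 Dc') (der_coord o2 Dt))
     (vderB (vderC z v (vec3 0 0 1)) (vderZ (der_coord o2 Dr) Dr))).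
have D2 : is_derive z v (fun q => dsurf w c (radial q) (tang q v))
    (- (dot v v * w (z 0 o2)) *: z + (2 * z 0 o2 * c (z 0 o2) * v 0 o2) *: v
     + (c (z 0 o2) * v 0 o2 ^+ 2) *: z
     - (dc * v 0 o2 ^+ 2 - dot v v * c (z 0 o2) * z 0 o2) *: (vec3 0 0 1 - z 0 o2 *: z)).
  apply: (is_derive_eq D); rewrite rz tang_id//.
  by apply: rV3_eq; rewrite !mxE/=; ring.
apply: near_eq_is_derive D2.
have nz : \forall q \near z, nonzero q.
  by apply: open_nbhs_nbhs; split => //; exact: open_nonzero.
near=> q; have q0 : nonzero q by near: q.
by have [_ ->] := der_ray_revolution prof v q0.
Unshelve. all: by end_near. Qed.

End SecondDerivatives.

(** * First variation of the pinching gap *)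

Section Evolution.
Context {R : realType}.

Lemma at_right_dnbhs (x : R) : (x^'+ : set_system R) `=>` x^'.
Proof.
move=> A [e /= e0 He]; exists e => //= y ye xy.
by apply: He => //; rewrite gt_eqF.
Qed.

Lemma is_derive_right (W : normedModType R) (f : R -> W) d : is_derive (0 : R) 1 f d ->
  h^-1 *: (f h - f 0) @[h --> 0^'+] --> d.
Proof.
move=> [df fd].
have cv : h^-1 *: (f h - f 0) @[h --> 0^'] --> d.
  move: df; rewrite -fd /derivable => df.
  have limE (F G : R -> W) : F =1 G -> cvg (F @ 0^') -> G @ 0^' --> lim (F @ 0^').
    by move=> /funext ->.
  by apply: limE df => h /=; rewrite addr0 [h *: 1]mulr1.
by apply: cvg_trans cv; apply: cvg_app; exact: at_right_dnbhs.
Qed.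

Lemma deriv_pos_near (f : R -> R) d : is_derive (0 : R) 1 f d -> 0 < d -> f 0 = 0 ->
  \forall t \near 0^'+, 0 < f t.
Proof.
move=> /is_derive_right cvr d0 f0.
near=> t; have t0 : 0 < t by near: t; exact: nbhs_right_gt.
have : 0 < t^-1 *: (f t - f 0).
  by near: t; move/cvgr_gt : cvr; exact.
by rewrite f0 subr0 /GRing.scale/= pmulr_rgt0// invr_gt0.
Unshelve. all: by end_near. Qed.

(** The frame consists of the meridian direction [E1] and the parallel direction
[E2] at the point [z]; [a0], [a1] are the first and [a00], ..., [a11] the second
derivatives of the position in this frame, as functions of time.  At time 0 the
mixed second derivatives have no normal component and the metric is diagonal, so
that the mixed terms enter [pinch_gap] quadratically and their time derivatives
[d01], [d10] drop out.  The numbers [b00] and [b11] are the time derivatives of the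
second derivatives paired with the normal, [A] and [dA] are the value and the time
derivative of the expression squared in [pinch_gap], and [dB] is the time derivative
of the product of determinants in its second term. *)
Lemma gap_evolution (a0 a1 a00 a01 a10 a11 : R -> 'rV[R]_3)
    (d01 d10 E1 E2 z : 'rV[R]_3) (rho W P u s c phi dphi h00 h11 r : R) :
  dot E1 E1 = 1 -> dot E2 E2 = 1 -> dot z z = 1 ->
  dot E1 E2 = 0 -> dot E1 z = 0 -> dot E2 z = 0 ->
  cross E1 E2 = z -> cross z E2 = - E1 ->
  a0 0 = rho *: E1 -> a1 0 = W *: E2 ->
  a00 0 = P *: E1 - rho *: z -> a11 0 = - W *: z - (c * u * s) *: E1 ->
  dot (a01 0) z = 0 -> dot (a10 0) z = 0 ->
  is_derive (0 : R) 1 a0 ((s * dphi) *: z - phi *: E1) ->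
  is_derive (0 : R) 1 a1 (- phi *: E2) ->
  is_derive (0 : R) 1 a00 (h00 *: z + (2 * dphi * s) *: E1) ->
  is_derive (0 : R) 1 a11 (h11 *: z) ->
  is_derive (0 : R) 1 a01 d01 -> is_derive (0 : R) 1 a10 d10 ->
  let b00 := h00 * rho * W - P * s * dphi * W + rho * phi * (W + rho) in
  let b11 := h11 * rho * W + c * u * s ^+ 2 * dphi * W + W * phi * (W + rho) in
  let A := - (rho ^+ 2 * W ^+ 2 * (W + rho)) in
  let dA := b00 * W ^+ 2 + 2 * rho ^+ 2 * W ^+ 2 * phi + b11 * rho ^+ 2 +
     2 * rho ^+ 2 * W ^+ 2 * phi in
  let dB := - 2 * phi * rho * W * (W + rho) * (rho ^+ 3 * W ^+ 3) - rho ^+ 2 * W ^+ 2 *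
     (b00 * rho * W ^+ 2 + b11 * rho ^+ 2 * W) in
  let gap t := pinch_gap r
    (dot (a0 t) (a0 t)) (dot (a0 t) (a1 t)) (dot (a1 t) (a0 t)) (dot (a1 t) (a1 t))
    (dot (a00 t) (cross (a0 t) (a1 t))) (dot (a01 t) (cross (a0 t) (a1 t)))
    (dot (a10 t) (cross (a0 t) (a1 t))) (dot (a11 t) (cross (a0 t) (a1 t))) in
  gap 0 = A ^+ 2 - (r + 2 + r^-1) * (rho ^+ 5 * W ^+ 5) /\
  is_derive (0 : R) 1 gap (2 * A * dA - (r + 2 + r^-1) * dB).
Proof.
move=> E11 E22 zz E12 E1z E2z cE czE v0 v1 v00 v11 v01 v10 D0 D1 D00 D11 D01 D10.
move=> b00 b11 A dA dB gap.
pose N t := cross (a0 t) (a1 t).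
have E21 : dot E2 E1 = 0 by rewrite dotC.
have zE1 : dot z E1 = 0 by rewrite dotC.
have zE2 : dot z E2 = 0 by rewrite dotC.
have N0 : N 0 = (rho * W) *: z.
  by rewrite /N v0 v1 -cE; apply: rV3_eq; rewrite !mxE/= ?mxE/=; ring.
have DN : is_derive (0 : R) 1 N (- (s * dphi * W) *: E1 - (phi * (W + rho)) *: z).
  apply: (is_derive_eq (dercross D0 D1)); rewrite v0 v1.
  transitivity ((s * dphi * W) *: cross z E2 - (phi * (W + rho)) *: cross E1 E2).
    by apply: rV3_eq; rewrite !mxE/= ?mxE/=; ring.
  by rewrite cE czE; apply: rV3_eq; rewrite !mxE; ring.
have G00 := derdot D0 D0; have G01 := derdot D0 D1; have G10 := derdot D1 D0.
have G11 := derdot D1 D1.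
have B00 := derdot D00 DN; have B01 := derdot D01 DN; have B10 := derdot D10 DN.
have B11 := derdot D11 DN.
have DA := derD (derB (derB (derM B00 G11) (derM B01 G10)) (derM B10 G01)) (derM B11 G00).
have DB := derM (derB (derM G00 G11) (derM G01 G10)) (derB (derM B00 B11) (derM B01 B10)).
have D := derB (derX 2 DA) (derM (@derC R R 0 1 (r + 2 + r^-1)) DB).
have dots := (@dotDl R, @dotDr R, @dotNl R, @dotNr R, @dotZl R, @dotZr R, E11, E22, zz, E12, E1z, E2z,
  E21, zE1, zE2, v01, v10).
split; first by rewrite /gap /pinch_gap -/(N 0) N0 v0 v1 v00 v11 !dots /A; ring.
apply: (is_derive_eq D); rewrite -?/(N 0) !N0 !v0 !v1 !v00 !v11 !dots /A /dA /dB /b00 /b11 expr1.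
ring.
Qed.

End Evolution.

(** * Time slices of a motion *)

Section Slices.
Context {R : realType}.
Implicit Types (W : set ('rV[R]_3 * R)) (p v : 'rV[R]_3) (t : R).

Lemma derive_coord (V : normedModType R) (n : nat) (f : V -> 'rV[R]_n.+1) (q b : V) i :
  derivable f q b -> ('D_b f q) 0 i = 'D_b (fun q => f q 0 i) q.
Proof. by move=> d; rewrite derive_mx// mxE. Qed.

Lemma derive_commute_rV (V : normedModType R) (n : nat) (f : V -> 'rV[R]_n.+1)
    (U : set V) (p u v : V) :
  open U -> U p -> Ck 2 U f -> 'D_u ('D_v f) p = 'D_v ('D_u f) p.
Proof.
move=> oU Up Cf; have [df Df] := Cf.
have E (a b : V) i : ('D_a ('D_b f) p) 0 i = 'D_a ('D_b (fun q => f q 0 i)) p.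
  have dD : derivable ('D_b f) p a.
    by apply: diff_derivable; have [+ _] := Df b; exact.
  rewrite (derive_coord _ dD); apply: near_eq_derive.
  have nU : \forall q \near p, U q by apply: open_nbhs_nbhs.
  by apply: filterS nU => q Uq; apply: derive_coord; apply: diff_derivable; exact: df.
have C i := derive_commute u v oU Up (Ck_coord i oU Cf).
by apply/rowP => i; exact: (etrans (E u v i) (etrans (C i) (esym (E v u i)))).
Qed.

Lemma derive_slice (W' : normedModType R) (g : 'rV[R]_3 * R -> W') p v t :
  'D_((v, 0) : 'rV[R]_3 * R) g (p, t) = 'D_v (fun q => g (q, t)) p.
Proof.
have limE (F G : R -> W') : F =1 G -> lim (F @ 0^') = lim (G @ 0^') by move=> /funext ->.
apply: limE => h /=; congr (_ *: (g _ - _)).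
by congr (_, _) => /=; rewrite scaler0 add0r.
Qed.

Lemma der_time_slice (g : 'rV[R]_3 * R -> 'rV[R]_3) p t : differentiable g (p, t) ->
  is_derive t 1 (fun s => g (p, s)) ('D_((0, 1) : 'rV[R]_3 * R) g (p, t)).
Proof.
move=> dg; apply/vderP => i.
have dgi : differentiable (fun q => g q 0 i) (p, t).
  by apply: (@differentiable_comp _ _ _ _ g (fun u : 'rV[R]_3 => u 0 i)) => //; exact: differentiable_coord.
have D : is_derive (p, t) ((0, 1) : 'rV[R]_3 * R) (fun q => g q 0 i)
   (('D_((0, 1) : 'rV[R]_3 * R) g (p, t)) 0 i).
  apply: (DeriveDef (diff_derivable dgi)).
  by rewrite derive_mx ?mxE//; exact: diff_derivable.
move: D => /der_line D; apply/der_line; move: D; congr (is_derive _ _ _ _).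
apply/funext => h; congr (g _ 0 i).
by congr (_, _) => /=; rewrite scaler0 add0r.
Qed.

Lemma differentiable_pairl t p : differentiable (fun q : 'rV[R]_3 => (q, t)) p.
Proof. by apply: differentiable_pair; [exact: ex_diff|exact: differentiable_cst]. Qed.

Lemma Ck_slice k W (g : 'rV[R]_3 * R -> 'rV[R]_3) t : Ck k W g ->
  Ck k [set q | W (q, t)] (fun q => g (q, t)).
Proof.
elim: k g => [|k IH] g.
  move=> Cg q Wq; apply: (@continuous_comp _ _ _ (fun q : 'rV[R]_3 => (q, t)) g).
    exact/differentiable_continuous/differentiable_pairl.
  exact: Cg.
move=> [dg Dg]; split=> [q Wq|v].
  apply: (@differentiable_comp _ _ _ _ (fun q : 'rV[R]_3 => (q, t)) g); last exact: dg.
  exact: differentiable_pairl.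
rewrite (_ : 'D_v _ = fun q => 'D_((v, 0) : 'rV[R]_3 * R) g (q, t)); first exact: (IH _ (Dg _)).
by apply/funext => q; rewrite derive_slice.
Qed.

Lemma open_slice W t : open W -> open [set q : 'rV[R]_3 | W (q, t)].
Proof.
move=> oW; apply: (@open_comp _ _ (fun q : 'rV[R]_3 => (q, t)) W) => // q _.
exact/differentiable_continuous/differentiable_pairl.
Qed.

End Slices.

(** * Locality of the curvatures *)

Section SameGeometry.
Context {R : realType}.
Implicit Types (x y : 'rV[R]_3 -> 'rV[R]_3) (z n : 'rV[R]_3).

Lemma near_ray_eq x (g : 'rV[R]_3 -> 'rV[R]_3) z E : (\forall p \near z, ray_ext x p = g p) ->
  (forall i, dx x z E i = 'D_(row i E) g z) /\
  (forall i j, ddx x z E i j = 'D_(row i E) ('D_(row j E) g) z).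
Proof.
move=> xg; split=> [i|i j]; first by rewrite dxE; exact: near_eq_derive.
rewrite ddxE; apply: near_eq_derive.
by apply: filterS (near_join xg) => q; exact: near_eq_derive.
Qed.

Lemma near_ray_ext_eq x y z : (forall q, S2 q -> x q = y q) -> S2 z ->
  \forall p \near z, ray_ext x p = ray_ext y p.
Proof.
move=> xy zS; have nz : \forall q \near z, nonzero q.
  by apply: open_nbhs_nbhs; split; [exact: open_nonzero|exact: S2_nonzero].
by apply: filterS nz => q /nonzeroP; exact: ray_ext_eq.
Qed.

Lemma same_geometry x y z E : (forall q, S2 q -> x q = y q) -> S2 z ->
  (forall i, dx x z E i = dx y z E i) /\ (forall i j, ddx x z E i j = ddx y z E i j).
Proof.
move=> xy zS; have [D1 D2] := near_ray_eq E (near_ray_ext_eq xy zS).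
by split=> [i|i j]; rewrite ?D1 ?D2 ?dxE ?ddxE.
Qed.

Lemma same_principal_curvatures x y z n k1 k2 : (forall q, S2 q -> x q = y q) -> S2 z ->
  principal_curvatures x z n k1 k2 -> principal_curvatures y z n k1 k2.
Proof.
move=> xy zS [k12 [E [tE H]]]; split; first exact: k12.
exists E; split; first exact: tE.
have [D1 D2] := same_geometry E xy zS.
have E1 : second_form y z E n = second_form x z E n.
  by apply/matrixP => i j; rewrite [LHS]mxE [RHS]mxE D2.
have E2 : metric y z E = metric x z E by apply/matrixP => i j; rewrite [LHS]mxE [RHS]mxE !D1.
by rewrite E1 E2.
Qed.

End SameGeometry.

(** * Positivity of the speed *)

Section Speed.
Context {R : realType}.

Lemma open_positive_cone : open (@positive_cone R).
Proof.
rewrite (_ : positive_cone = (fst @^-1` [set u : R | 0 < u]) `&` (snd @^-1` [set u : R | 0 < u])).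
  apply: openI.
    by apply: (@open_comp _ _ fst [set u : R | 0 < u]); [move=> q _; exact: cvg_fst|exact: open_gt].
  by apply: (@open_comp _ _ snd [set u : R | 0 < u]); [move=> q _; exact: cvg_snd|exact: open_gt].
by [].
Qed.

Lemma speed_differentiable (F : R -> R -> R) (a b : R) :
  smooth_on (@positive_cone R) (fun p : R * R => F p.1 p.2) -> 0 < a -> 0 < b ->
  differentiable (fun p : R * R => F p.1 p.2) (a, b).
Proof.
move=> sF a0 b0; have [//|U [g [oU Uab Cg Fg]]] := sF (a, b).
apply: (@near_eq_differentiable _ _ _ g); last by have [+ _] := Cg 1%N; exact.
have n1 : \forall p \near (a, b), U p by apply: open_nbhs_nbhs.
have n2 : \forall p \near (a, b), positive_cone p.
  by apply: open_nbhs_nbhs; split => //; exact: open_positive_cone.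
by apply: filterS2 n1 n2 => p Up Pp; rewrite Fg.
Qed.

Lemma increasing_of_derive1 (f : R -> R) (a b : R) : a < b ->
  (forall s, a <= s <= b -> derivable f s 1 /\ 0 < derive1 f s) -> f a < f b.
Proof.
move=> ab H; have [||y] := @MVT R f (derive1 f) a b ab.
- move=> y; rewrite in_itv/= => /andP[ay yb]; have [|d _] := H y; first by rewrite !ltW.
  by rewrite derive1E; exact: derivableP.
- apply: continuous_in_subspaceT => y; rewrite inE/= in_itv/= => yab.
  by apply: differentiable_continuous; apply/derivable1_diffP; have [] := H y yab.
rewrite in_itv/= => /andP[ay yb] E; rewrite -subr_gt0 E.
by have [|_ d] := H y; [rewrite !ltW|rewrite mulr_gt0// subr_gt0].
Qed.

(** Doubling both arguments increases [F] and multiplies it by [2 `^ alpha > 1]. *)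
Lemma speed_gt0 (alpha : R) (F : R -> R -> R) (a b : R) : 0 < alpha ->
  admissible_speed alpha F -> 0 < a -> 0 < b -> 0 < F a b.
Proof.
move=> al0 [sF _ hF dF] a0 b0.
have D1 s t : 0 < s -> 0 < t -> derivable (fun s => F s t) s 1.
  move=> s0 t0; apply/derivable1_diffP.
  apply: (@differentiable_comp _ _ _ _ (fun s : R => (s, t)) (fun p : R * R => F p.1 p.2)).
    by apply: differentiable_pair; [exact: ex_diff|exact: differentiable_cst].
  exact: speed_differentiable.
have D2 s t : 0 < s -> 0 < t -> derivable (fun t => F s t) t 1.
  move=> s0 t0; apply/derivable1_diffP.
  apply: (@differentiable_comp _ _ _ _ (fun t : R => (s, t)) (fun p : R * R => F p.1 p.2)).
    by apply: differentiable_pair; [exact: differentiable_cst|exact: ex_diff].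
  exact: speed_differentiable.
have lt2 (y : R) : 0 < y -> y < 2 * y by move=> y0; lra.
have m1 : F a b < F (2 * a) b.
  apply: (@increasing_of_derive1 (fun s => F s b)); first exact: lt2.
  move=> s /andP[sa _]; have s0 := lt_le_trans a0 sa.
  by split; [exact: D1|have [] := dF s b s0 b0].
have a20 : 0 < 2 * a by rewrite mulr_gt0.
have m2 : F (2 * a) b < F (2 * a) (2 * b).
  apply: (@increasing_of_derive1 (fun t => F (2 * a) t)); first exact: lt2.
  move=> s /andP[sb _]; have s0 := lt_le_trans b0 sb.
  by split; [exact: D2|have [] := dF (2 * a) s a20 s0].
have := lt_trans m1 m2; rewrite hF// => lt.
have p1 : 1 < 2 `^ alpha :> R.
  by rewrite /powR pnatr_eq0/= expR_gt1 mulr_gt0// ln_gt0// ltr1n.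
have : 0 < (2 `^ alpha - 1) * F a b by rewrite mulrBl mul1r subr_gt0.
by rewrite pmulr_rgt0// subr_gt0.
Qed.

End Speed.

(** * The first variation on a plateau *)

Section GapAlgebra.
Context {R : realType}.

(** The gap and its time derivative, as given by [gap_evolution], for the data of a
plateau at latitude [u]: there [c] and its derivative [dc] are determined by
[(1 - u^2) c = m w], and [dphi], [ddphi] are the derivatives of the speed
[phi = const * w ^ -alpha]. *)
Lemma gap_algebra (W u s r alpha phi m rho c dc : R) : W != 0 -> s != 0 -> r != 0 ->
  m = 1 - r^-1 -> rho = W / r -> c = m * W / s ^+ 2 ->
  dc = m * u * W * (m + 2) / s ^+ 4 ->
  let dphi := - alpha * (u * c / W) * phi in
  let ddphi := (- alpha * ((c + u * dc) / W - (u * c / W) ^+ 2) +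
     alpha ^+ 2 * (u * c / W) ^+ 2) * phi in
  let h00 := - ddphi * s ^+ 2 + (dphi * u + phi) in
  let h11 := dphi * u + phi in
  let P := - (3 * u * c * s) + dc * s ^+ 3 in
  let b00 := h00 * rho * W - P * s * dphi * W + rho * phi * (W + rho) in
  let b11 := h11 * rho * W + c * u * s ^+ 2 * dphi * W + W * phi * (W + rho) in
  let A := - (rho ^+ 2 * W ^+ 2 * (W + rho)) in
  let dA := b00 * W ^+ 2 + 2 * rho ^+ 2 * W ^+ 2 * phi + b11 * rho ^+ 2 +
     2 * rho ^+ 2 * W ^+ 2 * phi in
  let dB := - 2 * phi * rho * W * (W + rho) * (rho ^+ 3 * W ^+ 3) - rho ^+ 2 * W ^+ 2 *
     (b00 * rho * W ^+ 2 + b11 * rho ^+ 2 * W) in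
  A ^+ 2 - (r + 2 + r^-1) * (rho ^+ 5 * W ^+ 5) = 0 /\
  2 * A * dA - (r + 2 + r^-1) * dB =
  phi * W ^+ 9 * m ^+ 2 * r^-1 ^+ 3 * (1 + r^-1) *
    (alpha * (u ^+ 2 / s ^+ 2) * (alpha * m + m - 2) - (alpha - 1)).
Proof.
move=> W0 s0 r0 mE rhoE cE dcE dphi ddphi h00 h11 P b00 b11 A dA dB.
split; first by rewrite /A rhoE; field.
pose q := u ^+ 2 / s ^+ 2.
have hb00 : b00 = phi * W ^+ 2 * (1 - m) *
    (alpha * m * (1 + q) - alpha ^+ 2 * m ^+ 2 * q + 1 - alpha * m ^+ 2 * q + 2 - m).
  rewrite /b00 /h00 /P /ddphi /dphi dcE cE /q rhoE mE; field.
  by rewrite W0 s0 r0.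
have hb11 : b11 = phi * W ^+ 2 * ((1 - m) * (1 - alpha * m * q) - alpha * m ^+ 2 * q + (2 - m)).
  rewrite /b11 /h11 /dphi cE /q rhoE mE; field.
  by rewrite W0 s0 r0.
rewrite -/q /dA /dB hb00 hb11 /A rhoE mE; clearbody q; field.
exact: r0.
Qed.

End GapAlgebra.

(** * The flow of a surface of revolution with a plateau *)

Section Flow.
Context {R : realType}.
Variables (r alpha : R) (w c Z : R -> R).
Hypothesis r1 : 1 < r.
Hypothesis alpha1 : 1 < alpha.
Hypothesis prof : revolution_profile r w c Z.

Let x0 := revolution w Z.
Let rho u := w u - (1 - u ^+ 2) * c u.

Lemma powR_expR_ln (a b : R) : 0 < a -> a `^ b = expR (b * ln a).
Proof. by move=> a0; rewrite /powR gt_eqF. Qed.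

(** The speed [F (1/w) (1/rho)] where [w = r * rho], in a form that is easily
differentiated. *)
Definition plateau_speed (F : R -> R -> R) (u : R) : R :=
  F 1 r * expR (- (alpha * ln (w u))).

(** The curvatures of [x0] at the given point are [1/w] and [r/w], and the outward
normal is [nu]: with the opposite normal the smaller curvature would be negative,
contrary to strict convexity. *)
Lemma initial_velocity F T x nu : admissible_speed alpha F -> 0 < T ->
  flow_solution F T x0 x -> S2 nu ->
  (1 - nu 0 o2 ^+ 2) * c (nu 0 o2) = (1 - r^-1) * w (nu 0 o2) ->
  has_time_derivative T (x nu) 0 (normal_field (plateau_speed F) nu).
Proof.
move=> [_ _ hF _] T0 [_ conv xx0 vel] nuS plat; set u := nu 0 o2 in plat *.
have in0 : (0 : R) \in `[0, T[ by rewrite in_itv/= lexx T0.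
have [_ sc] := conv 0 in0.
have [n [k1 [k2 [on pc k10 k20]]]] := sc nu nuS.
have V := vel nu 0 n k1 k2 nuS in0 on pc.
have [nn tn _] := on.
have pc0 := same_principal_curvatures xx0 nuS pc.
have [E tE] := tangent_frame_exists nuS.
have tn0 i : dot (dx x0 nu E i) n = 0.
  have [D1 _] := same_geometry E xx0 nuS.
  by rewrite /x0 -D1; exact: tn.
have u1 := S2_coord nuS; have w0 := w_gt0 prof u1; have rh0 := rho_gt0 r1 prof u1.
have nz := normal_revolution r1 prof nuS tE nn tn0.
have [[nE [k1E k2E]]|[k1E _]] := principal_curvatures_revolution r1 prof nuS nz pc0; last first.
  by move: k10; rewrite k1E oppr_gt0 invr_lt0 ltNge ltW.
rewrite -/u in k1E k2E w0 rh0.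
have r0 : 0 < r by apply: lt_trans r1.
have rhE : k2 = (w u)^-1 * r.
  rewrite k2E plat (_ : w u - _ = r^-1 * w u); last by ring.
  by rewrite invfM invrK mulrC.
have FE : F k1 k2 = plateau_speed F u.
  have := hF (w u)^-1 1 r; rewrite invr_gt0 w0 => /(_ isT ltr01 r0).
  rewrite mulr1 -rhE -k1E => ->; rewrite powR_expR_ln// mulrC /plateau_speed.
  by rewrite k1E lnV ?posrE// mulrN.
by move: V; rewrite FE nE /normal_field radial_id.
Qed.

Lemma der_plateau_speed F (u : R) : -1 <= u <= 1 ->
  is_derive u 1 (plateau_speed F) (- alpha * (u * c u / w u) * plateau_speed F u).
Proof.
move=> u1; have w0 := w_gt0 prof u1.
have Dw := prof_dw prof (dom_itv u1).
have Dl := @der_comp1 R _ (@ln R) w u 1 _ _ (is_derive1_ln w0) Dw.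
have D := derM (derC u 1 (F 1 r)) (der_expR (derN (derM (derC u 1 alpha) Dl))).
by apply: (is_derive_eq D); rewrite /plateau_speed; field; rewrite gt_eqF.
Qed.

Definition dspace (v : 'rV[R]_3) (g : 'rV[R]_3 * R -> 'rV[R]_3) :=
  'D_((v, 0) : 'rV[R]_3 * R) g.
Definition dtime (g : 'rV[R]_3 * R -> 'rV[R]_3) := 'D_((0, 1) : 'rV[R]_3 * R) g.

Lemma dspace_slice v (g : 'rV[R]_3 * R -> 'rV[R]_3) p t :
  dspace v g (p, t) = 'D_v (fun q => g (q, t)) p.
Proof. exact: derive_slice. Qed.

Lemma dspace2_slice v v' (g : 'rV[R]_3 * R -> 'rV[R]_3) p t :
  dspace v (dspace v' g) (p, t) = 'D_v ('D_v' (fun q => g (q, t))) p.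
Proof.
rewrite dspace_slice; apply: (congr1 (fun f => 'D_v f p)).
by apply/funext => q; exact: dspace_slice.
Qed.

(** Time and space derivatives commute, so at [t = 0] the space derivatives of the
motion [G], of order at most 2, have as time derivatives the space derivatives
of the initial velocity [V]. *)
Lemma time_jet (G0 : set ('rV[R]_3 * R)) (B : set 'rV[R]_3) (G : 'rV[R]_3 * R -> 'rV[R]_3)
    (V Y : 'rV[R]_3 -> 'rV[R]_3) z : open G0 -> Ck 3 G0 G -> open B -> B z ->
  (forall p, B p -> [/\ G0 (p, 0), dtime G (p, 0) = V p & G (p, 0) = Y p]) ->
  [/\ forall v, dspace v G (z, 0) = 'D_v Y z,
    forall v, is_derive (0 : R) 1 (fun t => dspace v G (z, t)) ('D_v V z),
    forall v v', dspace v' (dspace v G) (z, 0) = 'D_v' ('D_v Y) z &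
    forall v v', is_derive (0 : R) 1 (fun t => dspace v' (dspace v G) (z, t))
      ('D_v' ('D_v V) z)].
Proof.
move=> oG CG oB Bz BG.
have [Gz _ _] := BG z Bz.
have nB : \forall p \near z, B p by apply: open_nbhs_nbhs.
have nBB p : B p -> \forall q \near p, B q by move=> Bp; apply: open_nbhs_nbhs.
have nG0 q : G0 q -> \forall q' \near q, G0 q' by move=> Gq; apply: open_nbhs_nbhs.
have DV v p : B p -> dspace v (dtime G) (p, 0) = 'D_v V p.
  move=> Bp; rewrite /dspace derive_slice; apply: near_eq_derive.
  by apply: filterS (nBB p Bp) => q /BG[].
have DDV v v' : dspace v' (dspace v (dtime G)) (z, 0) = 'D_v' ('D_v V) z.
  rewrite {1}/dspace derive_slice; apply: near_eq_derive.
  by apply: filterS nB => q; exact: DV.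
have C2 : Ck 2 G0 G := CkW CG.
have comm1 v q : G0 q -> dtime (dspace v G) q = dspace v (dtime G) q.
  by move=> Gq; apply: (derive_commute_rV _ _ oG Gq C2).
have comm2 v v' : dtime (dspace v' (dspace v G)) (z, 0) = dspace v' (dspace v (dtime G)) (z, 0).
  rewrite {1}/dtime (derive_commute_rV _ _ oG Gz (Ck_derive _ CG)).
  apply: near_eq_derive; apply: filterS (nG0 _ Gz) => q; exact: comm1.
have DY v p : B p -> dspace v G (p, 0) = 'D_v Y p.
  move=> Bp; rewrite /dspace derive_slice; apply: near_eq_derive.
  by apply: filterS (nBB p Bp) => q /BG[].
split.
- by move=> v; exact: DY.
- move=> v; rewrite -(DV v z Bz) -(comm1 v _ Gz); apply: der_time_slice.
  exact: (Ck_differentiable Gz (Ck_derive (v, 0) C2)).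
- move=> v v'; rewrite {1}/dspace derive_slice; apply: near_eq_derive.
  by apply: filterS nB => q; exact: DY.
- move=> v v'; rewrite -DDV -comm2; apply: der_time_slice.
  exact: (Ck_differentiable Gz (Ck_derive (v', 0) (Ck_derive (v, 0) CG))).
Qed.

(** The one-sided derivative of the solution at [t = 0] is the two-sided one of its
extension. *)
Lemma time_derivative_ext (T : R) (cc : R -> 'rV[R]_3) (G : 'rV[R]_3 * R -> 'rV[R]_3) p v :
  0 < T -> has_time_derivative T cc 0 v -> differentiable G (p, 0) ->
  G (p, 0) = cc 0 -> (\forall h \near 0^'+, G (p, h) = cc h) ->
  'D_((0, 1) : 'rV[R]_3 * R) G (p, 0) = v.
Proof.
move=> T0 cv dG G0 Gcc.
have c1 := is_derive_right (der_time_slice dG).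
have c2 : h^-1 *: (G (p, h) - G (p, 0)) @[h --> 0^'+] --> v.
  have sub : ((0:R)^'+ : set_system R) `=>` within `[0, T[ (0^').
    move=> A [e /= e0 He]; exists (Num.min e T) => /=; first by rewrite lt_min e0.
    move=> y /=; rewrite sub0r normrN lt_min => /andP[ye yT] y0.
    have y_n0 : y != 0 by rewrite gt_eqF.
    apply: He => //=; first by rewrite sub0r normrN.
    rewrite in_itv/= ltW//=; apply: le_lt_trans yT; exact: ler_norm.
  have c3 : (fun s => (s - 0)^-1 *: (cc s - cc 0)) @ (0:R)^'+ --> v.
    by apply: cvg_trans cv; apply: cvg_app; exact: sub.
  apply: cvg_trans c3; apply: near_eq_cvg.
  by apply: filterS Gcc => h ->; rewrite subr0 G0.
by apply: (cvg_unique _ c1 c2).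
Qed.

Section AtPoint.
Variables (u0 s : R).
Hypothesis s0 : 0 < s.
Hypothesis su : s ^+ 2 + u0 ^+ 2 = 1.
Hypothesis plateau : \forall u \near u0, (1 - u ^+ 2) * c u = (1 - r^-1) * w u.

Let z0 : 'rV[R]_3 := vec3 s 0 u0.
Let E1 : 'rV[R]_3 := vec3 u0 0 (- s).
Let E2 : 'rV[R]_3 := vec3 0 1 0.
Let m := 1 - r^-1.
Let W := w u0.
Let dc := m * u0 * W * (m + 2) / s ^+ 4.

Lemma s2E : 1 - u0 ^+ 2 = s ^+ 2. Proof. by rewrite -su addrK. Qed.

Lemma u0_itv : -1 <= u0 <= 1.
Proof. by have := sqr_ge0 s; move: su; rewrite !expr2 => ? ?; apply/andP; split; nra. Qed.

Lemma c_u0 : c u0 = m * W / s ^+ 2.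
Proof.
have := nbhs_singleton plateau; rewrite s2E -/m -/W => <-.
by rewrite mulrAC mulfV ?mul1r// expf_neq0// gt_eqF.
Qed.

(** On the plateau [c = m w / (1 - u^2)]. *)
Lemma der_c_u0 : is_derive u0 1 c dc.
Proof.
have s2n : 1 - u0 ^+ 2 != 0 by rewrite s2E expf_neq0// gt_eqF.
have Dw := prof_dw prof (dom_itv u0_itv).
have Dq := derB (derC u0 1 (1 : R)) (derX 2 (derId u0)).
have D := derM (derM (derC u0 1 m) Dw) (@derV R R (fun u : R => 1 - u ^+ 2) u0 1 _ s2n Dq).
have D' : is_derive u0 1 (fun u => m * w u * (1 - u ^+ 2)^-1) dc.
  apply: (is_derive_eq D); rewrite c_u0 s2E /dc -/W expr1.
  by field; rewrite gt_eqF.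
apply: near_eq_is_derive D'.
have nq : \forall u \near u0, 1 - u ^+ 2 != 0.
  have cq : {for u0, continuous (fun u : R => 1 - u ^+ 2)}.
    by apply: differentiable_continuous; apply/derivable1_diffP; have [] := Dq.
  by move/cvgr_neq0 : cq; exact.
by apply: filterS2 plateau nq => u Pu qu; rewrite -Pu mulrAC mulfV ?mul1r.
Qed.

Lemma der_dplateau F : is_derive u0 1 (fun u => - alpha * (u * c u / w u) * plateau_speed F u)
  ((- alpha * ((c u0 + u0 * dc) / W - (u0 * c u0 / W) ^+ 2) + alpha ^+ 2 * (u0 * c u0 / W) ^+ 2)
    * plateau_speed F u0).
Proof.
have u1 := u0_itv; have w0 := w_gt0 prof u1.
have w0n : w u0 != 0 by rewrite gt_eqF.
have Dw := prof_dw prof (dom_itv u1).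
have D := derM (derM (derC u0 1 (- alpha))
    (derM (derM (derId u0) der_c_u0) (@derV R R w u0 1 _ w0n Dw)))
  (der_plateau_speed F u1).
by apply: (is_derive_eq D); rewrite -/W; field.
Qed.

Lemma z0_S2 : S2 z0.
Proof. by rewrite /S2/= dotE !vec3E -su; ring. Qed.

Lemma frame_dots : [/\ dot E1 E1 = 1, dot E2 E2 = 1, dot E1 E2 = 0, dot E1 z0 = 0 & dot E2 z0 = 0].
Proof.
split; rewrite dotE !vec3E; try ring.
by rewrite -[RHS]su; ring.
Qed.

Lemma frame_cross : cross E1 E2 = z0 /\ cross z0 E2 = - E1.
Proof. by split; apply: rV3_eq; rewrite !mxE/=; ring. Qed.

Lemma e3_decomp : vec3 0 0 1 - u0 *: z0 = - s *: E1.
Proof.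
apply: rV3_eq; rewrite !mxE/=; try ring.
by rewrite -[X in X - _]su; ring.
Qed.

Definition frame0 : 'M[R]_(2, 3) := \matrix_(i < 2) (if i == 0 then E1 else E2).

Lemma row_frame0 : row 0 frame0 = E1 /\ row 1 frame0 = E2.
Proof. by split; rewrite rowK. Qed.

Lemma tangent_frame0 : tangent_frame z0 frame0.
Proof.
have [E11 E22 E12 E1z E2z] := frame_dots; have [R0 R1] := row_frame0.
split.
  rewrite mulmx_dot; apply/matrixP => i j; rewrite [LHS]mxE [RHS]mxE ord1.
  have -> : row 0 z0 = z0 by apply/rowP => k; rewrite mxE.
  by rewrite dotC; move: j; apply: ord2P; rewrite ?R0 ?R1.
have : frame0 *m frame0^T = 1%:M.
  rewrite mulmx_dot; apply/matrixP => i j; rewrite [LHS]mxE [RHS]mxE.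
  move: i j; apply: ord2P; apply: ord2P; rewrite ?R0 ?R1 ?E11 ?E22 ?E12//.
  by rewrite dotC E12.
by move=> H; apply/row_freeP; exists frame0^T.
Qed.

(** On the plateau the initial velocity is known at a whole neighbourhood [B] of
[z0], which gives all its derivatives at [z0]. *)
Lemma flow_extension F T x : admissible_speed alpha F -> 0 < T -> flow_solution F T x0 x ->
  exists (G0 : set ('rV[R]_3 * R)) (G : 'rV[R]_3 * R -> 'rV[R]_3) (B : set 'rV[R]_3),
    [/\ open G0, forall k, Ck k G0 G,
      forall p t, G0 (p, t) -> 0 <= t -> t < T -> G (p, t) = ray_ext (x^~ t) p,
      open B /\ B z0 & forall p, B p -> [/\ G0 (p, 0),
        dtime G (p, 0) = normal_field (plateau_speed F) p & G (p, 0) = ray_ext x0 p]].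
Proof.
move=> aF T0 fl; have [sx conv xx0 _] := fl.
have zS := z0_S2; have nz0 := S2_nonzero zS.
have [G0 [G [oG Gz CG GE]]] := smooth_motion_ext T0 sx zS.
pose phi := plateau_speed F.
have [B [oB Bz BG]] : exists B : set 'rV[R]_3, [/\ open B, B z0 &
    forall p, B p -> [/\ nonzero p, G0 (p, 0) & dtime G (p, 0) = normal_field phi p]].
  have cr : (fun q => radial q 0 o2) @ z0 --> u0.
    have <- : radial z0 0 o2 = u0 by rewrite radial_id// vec3E.
    exact: (Ck_continuous nz0 (Ck_radial_coord 0 o2)).
  have n1 : \forall p \near z0, (1 - radial p 0 o2 ^+ 2) * c (radial p 0 o2) =
       (1 - r^-1) * w (radial p 0 o2) := cr _ plateau.
  have n2 : \forall p \near z0, nonzero p.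
    by apply: open_nbhs_nbhs; split => //; exact: open_nonzero.
  have n3 : \forall p \near z0, G0 (p, 0).
    by apply: open_nbhs_nbhs; split => //; exact: open_slice.
  have : \forall p \near z0, [/\ nonzero p, G0 (p, 0) & dtime G (p, 0) = normal_field phi p].
    apply: filterS3 n1 n2 n3 => p Pp p0 Gp; split => //.
    have pS : S2 (radial p) by apply: radial_S2; exact/nonzeroP.
    have vel := initial_velocity aF T0 fl pS Pp.
    have -> : normal_field phi p = normal_field phi (radial p).
      by rewrite /normal_field (radial_id pS).
    apply: (time_derivative_ext T0 vel).
    - by have [+ _] := CG 1%N; exact.
    - by rewrite GE.
    - have nG : \forall h \near (0 : R), G0 (p, h).
        have /= oS : open [set h : R | G0 (p, h)].
          apply: (@open_comp _ _ (fun h : R => (p, h)) G0) => // h _.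
          apply: differentiable_continuous; apply: differentiable_pair; last exact: ex_diff.
          exact: differentiable_cst.
        by apply: open_nbhs_nbhs.
      near=> h; apply: GE; last by near: h; exact: nbhs_right_lt.
        by near: h; exact: cvg_at_right_filter nG.
      by apply: ltW; near: h; exact: nbhs_right_gt.
  move=> nP; exists (interior
    [set p | [/\ nonzero p, G0 (p, 0) & dtime G (p, 0) = normal_field phi p]]).
  split; [exact: open_interior|exact: nP|move=> p; exact: interior_subset].
exists G0, G, B; split => // p Bp; have [p0 Gp Vp] := BG p Bp; split => //.
rewrite GE//; apply: ray_ext_eq; last exact/nonzeroP.
by move=> q qS; exact: xx0.
Unshelve. all: by end_near. Qed.

(** At [z0] the gap vanishes for [t = 0] and has a positive time derivative, so it
is positive for small [t > 0]. *)
Lemma flow_pinching F T x : admissible_speed alpha F -> 0 < T ->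
  flow_solution F T x0 x ->
  alpha - 1 < alpha * (u0 ^+ 2 / s ^+ 2) * (alpha * m + m - 2) ->
  \forall t \near 0^'+, exists n k1 k2, [/\ outward_unit_normal (x^~ t) z0 n,
    principal_curvatures (x^~ t) z0 n k1 k2 & r < k2 / k1].
Proof.
move=> aF T0 fl cond; have [_ conv _ _] := fl.
have zS := z0_S2; have nz0 := S2_nonzero zS.
have [E11 E22 E12 E1z E2z] := frame_dots; have [cE czE] := frame_cross.
have [G0 [G [B [oG CG GE [oB Bz] BG]]]] := flow_extension aF T0 fl.
pose phi := plateau_speed F.
have [DX dD DDX dDD] := time_jet oG (CG 3%N) oB Bz BG.
have u1 := u0_itv; have Wp : 0 < W by exact: (w_gt0 prof u1).
have z3 : z0 0 o2 = u0 by rewrite vec3E.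
have E13 : E1 0 o2 = - s by rewrite vec3E.
have E23 : E2 0 o2 = 0 by rewrite vec3E.
have r0 : 0 < r by apply: lt_trans r1.
have rn0 : r != 0 by rewrite gt_eqF.
have sn0 : s != 0 by rewrite gt_eqF.
have Wn0 : W != 0 by rewrite gt_eqF.
pose dphi := - alpha * (u0 * c u0 / W) * phi u0.
pose ddphi := (- alpha * ((c u0 + u0 * dc) / W - (u0 * c u0 / W) ^+ 2) +
    alpha ^+ 2 * (u0 * c u0 / W) ^+ 2)
    * phi u0.
have Dphi (u : R) : -1 <= u <= 1 -> is_derive u 1 phi (- alpha * (u * c u / w u) * phi u).
  exact: der_plateau_speed.
have Ddphi : is_derive (z0 0 o2) 1 (fun u => - alpha * (u * c u / w u) * phi u) ddphi.
  by rewrite z3; exact: der_dplateau.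
have Dc : is_derive (z0 0 o2) 1 c dc by rewrite z3; exact: der_c_u0.
have rz : radial z0 = z0 by exact: radial_id.
(* Derivatives of the initial velocity at [z0] in tangent directions, then those
   of the initial surface. *)
have V1 v : dot v z0 = 0 -> 'D_v (normal_field phi) z0 = - (dphi * v 0 o2) *: z0 - phi u0 *: v.
  move=> vz; have Dphi0 : is_derive (radial z0 0 o2) 1 phi dphi by rewrite rz z3; exact: Dphi.
  have [_ ->] := der_normal_field v nz0 Dphi0; rewrite rz tang_id// ?z3.
  by move: (z0) => y; apply: rV3_eq; rewrite !mxE; ring.
have V2 v : dot v z0 = 0 -> 'D_v ('D_v (normal_field phi)) z0 =
    (- ddphi * v 0 o2 ^+ 2 + dot v v * (dphi * u0 + phi u0)) *: z0 - (2 * dphi * v 0 o2) *: v.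
  by move=> vz; have [_ ->] := der2_normal_field zS vz Dphi Ddphi; rewrite z3.
have X1 v : dot v z0 = 0 -> 'D_v (ray_ext x0) z0 = W *: v + (c u0 * v 0 o2 * s) *: E1.
  move=> vz; have [_ ->] := der_ray_revolution prof v nz0; rewrite rz tang_id// /dsurf z3.
  by rewrite e3_decomp scalerA mulrN scaleNr opprK.
have X2 v : dot v z0 = 0 -> 'D_v ('D_v (ray_ext x0)) z0 =
    (c u0 * v 0 o2 ^+ 2 - dot v v * W) *: z0 + (2 * u0 * c u0 * v 0 o2) *: v
    + ((dc * v 0 o2 ^+ 2 - dot v v * c u0 * u0) * s) *: E1.
  move=> vz; have [_ ->] := der2_revolution prof zS vz Dc; rewrite z3 e3_decomp.
  rewrite -/W; move: (z0) (E1) (dot v v) (c u0) (dc) (W) => y y' d cu dcu W'.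
  by apply: rV3_eq; rewrite !mxE; ring.
(* The frame directions are principal, so the mixed derivatives are tangent. *)
have mix v v' : dot v z0 = 0 -> dot v' z0 = 0 -> dot v v' = 0 -> v 0 o2 * v' 0 o2 = 0 ->
    dot ('D_v' ('D_v (ray_ext x0)) z0) z0 = 0.
  move=> vz v'z vv' v33; rewrite (second_derivative_normal prof)// !tang_id//.
  rewrite /dsurf z3 e3_decomp dotDl dotNl !dotZl vv' /E1 dotE !vec3E.
  have v'z2 : v' 0 o0 * s + v' 0 o2 * u0 = 0.
    by move: v'z; rewrite dotE !vec3E mulr0 addr0.
  have -> : u0 * v' 0 o0 + 0 * v' 0 o1 + - s * v' 0 o2 = 
     (u0 * (v' 0 o0 * s + v' 0 o2 * u0) - v' 0 o2 * (s ^+ 2 + u0 ^+ 2)) / s by field.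
  rewrite v'z2 su; transitivity (c u0 * (v 0 o2 * v' 0 o2)); first by field.
  by rewrite v33 mulr0.
pose rh := W / r.
pose P := - (3 * u0 * c u0 * s) + dc * s ^+ 3.
pose h00 := - ddphi * s ^+ 2 + (dphi * u0 + phi u0).
pose h11 := dphi * u0 + phi u0.
have rhE : rh = W - c u0 * s ^+ 2.
  by rewrite c_u0 /rh /m; field; rewrite rn0 sn0.
pose a0 (t : R) := dspace E1 G (z0, t); pose a1 (t : R) := dspace E2 G (z0, t).
pose a00 (t : R) := dspace E1 (dspace E1 G) (z0, t).
pose a01 (t : R) := dspace E1 (dspace E2 G) (z0, t).
pose a10 (t : R) := dspace E2 (dspace E1 G) (z0, t).
pose a11 (t : R) := dspace E2 (dspace E2 G) (z0, t).
have v0 : a0 0 = rh *: E1.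
  rewrite /a0 DX X1// E13 rhE.
  by move: (E1) (W) (c u0) => y W' cu; apply: rV3_eq; rewrite !mxE; ring.
have v1 : a1 0 = W *: E2.
  by rewrite /a1 DX X1// E23 mulr0 mul0r scale0r addr0.
have v00 : a00 0 = P *: E1 - rh *: z0.
  rewrite /a00 DDX X2// E13 E11 rhE /P.
  by move: (E1) (z0) (W) (c u0) (dc) => y y' W' cu dcu; apply: rV3_eq; rewrite !mxE; ring.
have v11 : a11 0 = - W *: z0 - (c u0 * u0 * s) *: E1.
  rewrite /a11 DDX X2// E23 E22.
  by move: (E1) (z0) (E2) (W) (c u0) (dc) => y y' y2 W' cu dcu; apply: rV3_eq; rewrite !mxE; ring.
have v01 : dot (a01 0) z0 = 0.
  by rewrite /a01 DDX; apply: mix => //; rewrite ?E23 ?mul0r// dotC.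
have v10 : dot (a10 0) z0 = 0.
  by rewrite /a10 DDX; apply: mix => //; rewrite E23 mulr0.
have D0 : is_derive (0 : R) 1 a0 ((s * dphi) *: z0 - phi u0 *: E1).
  apply: (is_derive_eq (dD E1)); rewrite V1// E13; congr (_ *: _ - _).
  by rewrite mulrN opprK mulrC.
have D1 : is_derive (0 : R) 1 a1 (- phi u0 *: E2).
  by apply: (is_derive_eq (dD E2)); rewrite V1// E23 mulr0 oppr0 scale0r add0r scaleNr.
have D00 : is_derive (0 : R) 1 a00 (h00 *: z0 + (2 * dphi * s) *: E1).
  apply: (is_derive_eq (dDD E1 E1)); rewrite V2// E13 E11 /h00.
  move: (E1) (z0) (dphi) (ddphi) (phi u0) => y y' d dd p.
  by apply: rV3_eq; rewrite !mxE; ring.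
have D11 : is_derive (0 : R) 1 a11 (h11 *: z0).
  apply: (is_derive_eq (dDD E2 E2)); rewrite V2// E23 E22 /h11.
  move: (E2) (z0) (dphi) (ddphi) (phi u0) => y y' d dd p.
  by apply: rV3_eq; rewrite !mxE; ring.
have [g0 dg] := @gap_evolution R a0 a1 a00 a01 a10 a11 _ _ E1 E2 z0 rh W P u0 s (c u0) (phi u0)
  dphi h00 h11 r E11 E22 zS E12 E1z E2z cE czE v0 v1 v00 v11 v01 v10 D0 D1 D00 D11
  (dDD E2 E1) (dDD E1 E2).
have [A1 A2] := @gap_algebra R W u0 s r alpha (phi u0) m rh (c u0) dc Wn0 sn0 rn0
  erefl erefl c_u0 erefl.
have Z0 := etrans g0 A1.
have phi0 : 0 < phi u0.
  by rewrite mulr_gt0 ?expR_gt0//; apply: (speed_gt0 _ aF) => //; exact: lt_trans alpha1.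
have m0 : 0 < m by rewrite subr_gt0 invf_lt1.
have val0 : 0 < phi u0 * W ^+ 9 * m ^+ 2 * r^-1 ^+ 3 * (1 + r^-1) *
    (alpha * (u0 ^+ 2 / s ^+ 2) * (alpha * m + m - 2) - (alpha - 1)).
  have ri : 0 < r^-1 by rewrite invr_gt0.
  have ri1 : 0 < 1 + r^-1 by exact: addr_gt0.
  rewrite mulr_gt0 ?subr_gt0//; apply: mulr_gt0 => //; apply: mulr_gt0; last exact: exprn_gt0.
  by apply: mulr_gt0; [apply: mulr_gt0 => //|]; exact: exprn_gt0.
have gap_pos := deriv_pos_near (is_derive_eq dg A2) val0 Z0.
have nG : \forall t \near 0^'+, G0 (z0, t).
  have oS : open [set t : R | G0 (z0, t)].
    apply: (@open_comp _ _ (fun t : R => (z0, t)) G0) => // t _.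
    apply: differentiable_continuous; apply: differentiable_pair; last exact: ex_diff.
    exact: differentiable_cst.
  have [Gz _ _] := BG _ Bz.
  apply: (cvg_at_right_filter cvg_id).
  by apply: open_nbhs_nbhs; split; [exact: oS|exact: Gz].
have nT : \forall t \near 0^'+, t < T by exact: nbhs_right_lt.
have n0 : \forall t \near 0^'+, (0 : R) < t by exact: nbhs_right_gt.
have n4 : \forall t \near 0^'+, [/\ G0 (z0, t), t < T & (0 : R) < t].
  by apply: filterS3 nG nT n0 => t.
apply: filterS2 gap_pos n4 => t gap_t [Gt tT t0].
have tI : t \in `[0, T[ by rewrite in_itv/= ltW.
have [imm sc] := conv t tI.
have [n [k1 [k2 [on pc k10 k20]]]] := sc z0 zS.
exists n, k1, k2; split => //.
have oU : open [set q | G0 (q, t)] by exact: open_slice.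
have slice_eq q : G0 (q, t) -> ray_ext (x^~ t) q = G (q, t) by move=> Gq; rewrite GE// ltW.
have C2 : C2_at (x^~ t) z0.
  exists [set q | G0 (q, t)]; split => //.
  by apply: (Ck_ext oU _ (Ck_slice t (CG 2%N))) => q /slice_eq ->.
have [X1t X2t] := @near_ray_eq R (x^~ t) (fun q => G (q, t)) z0 frame0
  (filterS slice_eq (open_nbhs_nbhs (conj oU Gt))).
have [R0 R1] := row_frame0; have [nn tn _] := on.
apply: (pinching_from_frame C2 zS imm tangent_frame0 nn tn pc k10 r1).
have ddxE' i j : ddx (x^~ t) z0 frame0 i j =
    dspace (row i frame0) (dspace (row j frame0) G) (z0, t).
  by rewrite X2t dspace2_slice.
have dxE' i : dx (x^~ t) z0 frame0 i = dspace (row i frame0) G (z0, t).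
  by rewrite X1t dspace_slice.
by rewrite !dxE' !ddxE' !R0 !R1; exact: gap_t.
Qed.

End AtPoint.
End Flow.

(** * The theorem *)

(** [alpha m + m - 2 = (alpha - 1) / r * (r - r0)], with
[r0 = 1 + 2 / (alpha - 1)], is positive; so the last inequality holds when the
square [q] of the tangent of the latitude is large enough. *)
Lemma latitude_exists (R : realType) (alpha r : R) : 1 < alpha -> 1 + 2 / (alpha - 1) < r ->
  exists u0 s : R, [/\ 0 < u0 < 1, 0 < s, s ^+ 2 + u0 ^+ 2 = 1 &
    alpha - 1 < alpha * (u0 ^+ 2 / s ^+ 2) * (alpha * (1 - r^-1) + (1 - r^-1) - 2)].
Proof.
move=> alpha1 r1; have a1 : 0 < alpha - 1 by rewrite subr_gt0.
have a0 : 0 < alpha by exact: lt_trans alpha1.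
have r0 : 0 < r.
  by apply: lt_trans r1; rewrite addr_gt0// divr_gt0.
have k0 : 0 < alpha * (1 - r^-1) + (1 - r^-1) - 2.
  have -> : alpha * (1 - r^-1) + (1 - r^-1) - 2 = (alpha - 1) / r * (r - (1 + 2 / (alpha - 1))).
    by field; rewrite !gt_eqF.
  by rewrite mulr_gt0 ?subr_gt0// divr_gt0.
move: k0; set k := alpha * (1 - r^-1) + (1 - r^-1) - 2 => k0.
have [q q0 qE] : exists2 q : R, 0 < q & alpha - 1 < alpha * q * k.
  exists ((alpha - 1) / (alpha * k) + 1); first by rewrite addr_gt0// divr_gt0// mulr_gt0.
  have -> : alpha * ((alpha - 1) / (alpha * k) + 1) * k = alpha - 1 + alpha * k.
    by field; rewrite !gt_eqF.
  by rewrite ltrDl mulr_gt0.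
have q1 : 0 < 1 + q by rewrite addr_gt0.
exists (Num.sqrt (q / (1 + q))), (Num.sqrt (1 + q)^-1).
have Su : Num.sqrt (q / (1 + q)) ^+ 2 = q / (1 + q) by rewrite sqr_sqrtr// divr_ge0 ?ltW.
have Ss : Num.sqrt (1 + q)^-1 ^+ 2 = (1 + q)^-1 by rewrite sqr_sqrtr// invr_ge0 ltW.
rewrite Su Ss; split.
- rewrite sqrtr_gt0 divr_gt0//= -[ltRHS](sqrtr1 R) ltr_sqrt//.
  by rewrite ltr_pdivrMr// mul1r ltrDr.
- by rewrite sqrtr_gt0 invr_gt0.
- by field; rewrite gt_eqF.
- by have -> : q / (1 + q) / (1 + q)^-1 = q by field; rewrite gt_eqF.
Qed.

Theorem mainTheorem5 (R : realType) (alpha : R) (halpha : 1 < alpha)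
    (r1 : R) (hr1 : 1 + 2 / (alpha - 1) < r1) :
  exists x0 : 'rV[R]_3 -> 'rV[R]_3,
    [/\ smooth_embedding x0, strictly_convex x0, pinching_ratio x0 = r1%:E
      & forall F : R -> R -> R, admissible_speed alpha F ->
        forall (T : R) (x : 'rV[R]_3 -> R -> 'rV[R]_3),
          0 < T -> flow_solution F T x0 x ->
          \forall t \near 0^'+,
            (pinching_ratio x0 < pinching_ratio (x^~ t))%E].
Proof.
have r_gt1 : 1 < r1.
  by apply: lt_trans hr1; rewrite ltrDl divr_gt0// subr_gt0.
have [u0 [s [u01 s0 su cond]]] := latitude_exists halpha hr1.
have [w [c [Z [prof plateau]]]] := profile_exists r_gt1 u01.
have zS := z0_S2 su.
have ratio0 : pinching_ratio (revolution w Z) = r1%:E.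
  apply: (pinching_ratio_revolution r_gt1 prof zS).
  rewrite vec3E/= (nbhs_singleton plateau).
  by field; rewrite gt_eqF// (lt_trans ltr01).
exists (revolution w Z); split => //.
- exact: smooth_embedding_revolution r_gt1 prof.
- exact: strictly_convex_revolution r_gt1 prof.
move=> F aF T x T0 fl; rewrite ratio0.
apply: filterS (flow_pinching r_gt1 halpha prof s0 su plateau aF T0 fl cond).
move=> t [n [k1 [k2 [on pc lt_r]]]].
apply: (@lt_le_trans _ _ (k2 / k1)%:E); first by rewrite lte_fin.
by apply: ereal_sup_ubound; exists (vec3 s 0 u0), n, k1, k2.
Qed.
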